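(* Let $\mathcal{Q}$ be the space of quadrilaterals modulo similarity, parameterized as described in the context. The set of all $\frac{\pi}{107}$-near square quadrilaterals in $\mathcal{Q}$ is contained in the union of finitely many orbit tiles. In particular, every $\frac{\pi}{107}$-near square quadrilateral has a periodic billiard path.
   Context: Parameterization: a quadrilateral is cut by a diagonal into two triangles. The four angles $(a_1,a_2,a_3,a_4)$ that this diagonal makes with the four sides (the angles of the two triangles at the endpoints of the diagonal) determine the quadrilateral up to similarity, so $\mathcal{Q}\subset\mathbb{R}^4$. For $\varepsilon>0$, a quadrilateral with parameters $(a_1,a_2,a_3,a_4)$ is called $\varepsilon$-near square if $|a_i-\pi/4|<\varepsilon$ for every $i$. A billiard path in a polygon is a straight-line trajectory inside the polygon that reflects off the sides with angle of incidence equal to angle of reflection. Trajectories hitting vertices are excluded. It is periodic if it repeats itself. The sides of a quadrilateral are labelled $0,1,2,3$. The orbit type of a periodic billiard path is the word recording the labels of the sides hit during one period. If this word has odd length, the orbit type is its square, so orbit types always have even length. For a word $W$, the orbit tile $O(W)\subset\mathcal{Q}$ is the set of quadrilaterals that have a periodic billiard path of orbit type $W$. *)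

(* Defs.v *)
From Stdlib Require Import Reals Lra List.
Open Scope R_scope.

Definition pt : Type := (R * R)%type.
Definition padd (p q : pt) : pt := (fst p + fst q, snd p + snd q).
Definition psub (p q : pt) : pt := (fst p - fst q, snd p - snd q).
Definition pscale (c : R) (p : pt) : pt := (c * fst p, c * snd p).
Definition pdot (p q : pt) : R := fst p * fst q + snd p * snd q.
Definition pcomb (t : R) (p q : pt) : pt := padd (pscale (1 - t) p) (pscale t q).

Record qparams : Type := QP { a1 : R; a2 : R; a3 : R; a4 : R }.

(** The space Q: the two triangles cut by the diagonal are genuine triangles. *)
Definition in_Q (a : qparams) : Prop :=
  0 < a1 a /\ 0 < a2 a /\ 0 < a3 a /\ 0 < a4 a /\
  a1 a + a2 a < PI /\ a3 a + a4 a < PI.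

(** Realisation (a representative of the similarity class): diagonal from
    A = (0,0) to C = (1,0); triangle ABC above the diagonal with angle a1 at A
    and a2 at C; triangle ACD below with angle a3 at C and a4 at A.
    Vertices numbered 0 = A, 1 = B, 2 = C, 3 = D; side k joins vertex k and
    vertex k+1 (mod 4), so the sides are 0 = AB, 1 = BC, 2 = CD, 3 = DA. *)
Definition vA : pt := (0, 0).
Definition vC : pt := (1, 0).
Definition vB (a : qparams) : pt :=
  let r := sin (a2 a) / sin (a1 a + a2 a) in (r * cos (a1 a), r * sin (a1 a)).
Definition vD (a : qparams) : pt :=
  let r := sin (a3 a) / sin (a3 a + a4 a) in (r * cos (a4 a), - (r * sin (a4 a))).

Definition vertex (a : qparams) (k : nat) : pt :=
  match k mod 4 with
  | 0%nat => vA
  | 1%nat => vB a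
  | 2%nat => vC
  | _ => vD a
  end.

Definition in_open_triangle (P X Y Z : pt) : Prop :=
  exists l1 l2 l3 : R, 0 < l1 /\ 0 < l2 /\ 0 < l3 /\ l1 + l2 + l3 = 1 /\
    P = padd (pscale l1 X) (padd (pscale l2 Y) (pscale l3 Z)).

Definition in_interior (a : qparams) (P : pt) : Prop :=
  in_open_triangle P vA (vB a) vC \/ in_open_triangle P vA vC (vD a) \/
  (exists t, 0 < t < 1 /\ P = pcomb t vA vC).

Definition on_open_side (a : qparams) (k : nat) (P : pt) : Prop :=
  exists t, 0 < t < 1 /\ P = pcomb t (vertex a k) (vertex a (S k)).

Definition reflect (e v : pt) : pt :=
  psub (pscale (2 * pdot v e / pdot e e) e) v.

(** A periodic billiard path in the quadrilateral whose orbit type (word of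
    side labels hit during one period) is W: bounce points p 0, ..., p (n-1)
    (indices mod n), p i in the interior of side (nth i W), consecutive bounces
    on different sides, each open segment between consecutive bounces inside
    the interior of the quadrilateral, and the reflection law at every bounce. *)
Definition has_periodic_path (a : qparams) (W : list nat) : Prop :=
  let n := length W in
  (0 < n)%nat /\ Forall (fun s => (s < 4)%nat) W /\
  exists p : nat -> pt,
    forall i : nat, (i < n)%nat ->
      let s := nth i W 0%nat in
      let inext := ((i + 1) mod n)%nat in
      let iprev := ((i + n - 1) mod n)%nat in
      on_open_side a s (p i) /\
      s <> nth inext W 0%nat /\
      (forall u, 0 < u < 1 -> in_interior a (pcomb u (p i) (p inext))) /\
      exists lam : R, 0 < lam /\
        psub (p inext) (p i) =
        pscale lam (reflect (psub (vertex a (S s)) (vertex a s))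
                            (psub (p i) (p iprev))).

Definition orbit_tile (W : list nat) (a : qparams) : Prop :=
  in_Q a /\ has_periodic_path a W.

Definition near_square (eps : R) (a : qparams) : Prop :=
  Rabs (a1 a - PI / 4) < eps /\ Rabs (a2 a - PI / 4) < eps /\
  Rabs (a3 a - PI / 4) < eps /\ Rabs (a4 a - PI / 4) < eps.

(* Main.v *)
Require Import Defs.
From Stdlib Require Import Reals List Arith Lra Lia Psatz.
Import ListNotations.
Open Scope R_scope.

(** Let the acuteness of a vertex be [PI / 2] minus its angle; the four acutenesses add
    up to 0 and are smaller than 1/16 in absolute value. If two adjacent vertices are
    acute, the orthic (Fagnano) path of the three sides around them, run twice, works.
    If two opposite vertices are acute, so does the word 01203213 (up to rotation). If
    exactly one vertex is acute, with acuteness [e], then one of its neighbours has angle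
    [PI / 2 + d] with [0 <= 2 d <= e], and the three sides around these two vertices carry
    a path that leaves one side perpendicularly, hits a side perpendicularly and retraces
    itself. Its word depends on the position of [d / e] in [[0, 1/2]]: there are stable
    words of length 20 and 28 for the open intervals (0, 1/3) and (1/3, 1/2), and words of
    length 6, 8 and 10 for the points 0, 1/3 and 1/2. If no vertex is acute, the
    quadrilateral is a rectangle. *)

(** * The realised quadrilateral in polar form *)

Definition cross (u v : pt) : R := fst u * snd v - snd u * fst v.
Definition edge (a : qparams) (k : nat) : pt := psub (vertex a (S k)) (vertex a k).
(** The angles at [B] and [D] are angles of triangles, so only those at [A] and [C], which the
    diagonal divides, can fail to be convex. *)
Definition convex_quad (a : qparams) : Prop :=
  in_Q a /\ a1 a + a4 a < PI /\ a2 a + a3 a < PI.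

(** Side lengths by the law of sines, the diagonal having length 1. *)
Definition len0 a := sin (a2 a) / sin (a1 a + a2 a).
Definition len1 a := sin (a1 a) / sin (a1 a + a2 a).
Definition len2 a := sin (a4 a) / sin (a3 a + a4 a).
Definition len3 a := sin (a3 a) / sin (a3 a + a4 a).

Ltac pts := unfold pcomb, padd, psub, pscale, pdot, cross in *; simpl in *.

Lemma pt_eq (p q : pt) : fst p = fst q -> snd p = snd q -> p = q.
Proof. destruct p, q; simpl; intros; subst; reflexivity. Qed.

Lemma in_Q_sin_pos (a : qparams) : in_Q a ->
  0 < sin (a1 a) /\ 0 < sin (a2 a) /\ 0 < sin (a3 a) /\ 0 < sin (a4 a) /\
  0 < sin (a1 a + a2 a) /\ 0 < sin (a3 a + a4 a).
Proof.
intros (h1 & h2 & h3 & h4 & h5 & h6).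
repeat split; apply sin_gt_0; lra.
Qed.

Lemma len_pos (a : qparams) : in_Q a ->
  0 < len0 a /\ 0 < len1 a /\ 0 < len2 a /\ 0 < len3 a.
Proof.
intro h; destruct (in_Q_sin_pos a h) as (h1 & h2 & h3 & h4 & h5 & h6).
unfold len0, len1, len2, len3; repeat split; apply Rdiv_lt_0_compat; assumption.
Qed.

Lemma vC_vB (a : qparams) : in_Q a ->
  vC = padd (vB a) (pscale (len1 a) (cos (a2 a), - sin (a2 a))).
Proof.
intro h; destruct (in_Q_sin_pos a h) as (h1 & h2 & h3 & h4 & h5 & h6).
unfold vB, vC, len1; apply pt_eq; pts; [|field; lra].
apply Rmult_eq_reg_r with (sin (a1 a + a2 a)); [|lra].
field_simplify; [rewrite sin_plus; ring | lra].
Qed.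

Lemma vC_vD (a : qparams) : in_Q a ->
  vC = padd (vD a) (pscale (len2 a) (cos (a3 a), sin (a3 a))).
Proof.
intro h; destruct (in_Q_sin_pos a h) as (h1 & h2 & h3 & h4 & h5 & h6).
unfold vD, vC, len2; apply pt_eq; pts; [|field; lra].
apply Rmult_eq_reg_r with (sin (a3 a + a4 a)); [|lra].
field_simplify; [rewrite sin_plus; ring | lra].
Qed.

Lemma vB_polar (a : qparams) :
  vB a = padd vA (pscale (len0 a) (cos (a1 a), sin (a1 a))).
Proof. unfold vB, vA, len0; apply pt_eq; pts; ring. Qed.

Lemma vD_polar (a : qparams) :
  vD a = padd vA (pscale (len3 a) (cos (a4 a), - sin (a4 a))).
Proof. unfold vD, vA, len3; apply pt_eq; pts; ring. Qed.

(** * Convexity and the interior *)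

(** The cross products at [A] and [C] are minus the product of the two side lengths there and the
    sine of the angle, which is positive by convexity. *)
Lemma convex_signs (a : qparams) : convex_quad a ->
  0 < snd (vB a) /\ snd (vD a) < 0 /\ cross (vB a) (vD a) < 0 /\
  cross (psub vC (vB a)) (psub (vD a) vC) < 0.
Proof.
intros (h & hA & hC); destruct (in_Q_sin_pos a h) as (h1 & h2 & h3 & h4 & h5 & h6).
destruct (len_pos a h) as (l0 & l1 & l2 & l3).
assert (HB := vC_vB a h); assert (HD := vC_vD a h).
destruct h as (p1 & p2 & p3 & p4 & _).
split; [|split; [|split]].
- rewrite vB_polar; pts; nra.
- rewrite vD_polar; pts; nra.
- rewrite vB_polar, vD_polar.
  replace (cross _ _) with (- (len0 a * len3 a * sin (a1 a + a4 a)))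
    by (rewrite sin_plus; pts; ring).
  assert (0 < sin (a1 a + a4 a)) by (apply sin_gt_0; lra).
  assert (0 < len0 a * len3 a) by (apply Rmult_lt_0_compat; lra). nra.
- replace (psub vC (vB a)) with (pscale (len1 a) (cos (a2 a), - sin (a2 a)))
    by (rewrite HB at 1; apply pt_eq; pts; ring).
  replace (psub (vD a) vC) with (pscale (- len2 a) (cos (a3 a), sin (a3 a)))
    by (rewrite HD; apply pt_eq; pts; ring).
  replace (cross _ _) with (- (len1 a * len2 a * sin (a2 a + a3 a)))
    by (rewrite sin_plus; pts; ring).
  assert (0 < sin (a2 a + a3 a)) by (apply sin_gt_0; lra).
  assert (0 < len1 a * len2 a) by (apply Rmult_lt_0_compat; lra). nra.
Qed.

(* Negative exactly on the interior side of side [k], the vertices being in clockwise order. *)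
Definition side_form (a : qparams) (k : nat) (q : pt) : R :=
  cross (edge a k) (psub q (vertex a k)).

Lemma side_form_comb (a : qparams) (k : nat) (t : R) (p q : pt) :
  side_form a k (pcomb t p q) = (1 - t) * side_form a k p + t * side_form a k q.
Proof. unfold side_form, edge; pts; ring. Qed.

Ltac four k := destruct k as [|[|[|[|k]]]]; [| | | |exfalso; lia].

(** The form is affine along side [j]. It vanishes at no more than one end, because distinct sides
    share at most one vertex, and [convex_signs] makes every other value negative. *)
Lemma side_form_other (a : qparams) (j k : nat) (q : pt) : convex_quad a ->
  (j < 4)%nat -> (k < 4)%nat -> j <> k -> on_open_side a j q -> side_form a k q < 0.
Proof.
intros h hj hk hjk (t & ht & ->).
destruct (convex_signs a h) as (s1 & s2 & s3 & s4).
rewrite side_form_comb.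
four j; four k; try (exfalso; lia); unfold side_form, edge, vertex; simpl;
unfold vA, vC in *; pts; nra.
Qed.

Lemma side_form_self (a : qparams) (k : nat) (q : pt) :
  on_open_side a k q -> side_form a k q = 0.
Proof. intros (t & _ & ->); unfold side_form, edge; pts; ring. Qed.

(** The sign of the second coordinate decides on which side of the diagonal [q] lies. Its
    barycentric coordinates in that triangle are, up to a common sign, that coordinate and the forms
    of the two sides of the triangle, divided by the ordinate of the apex. *)
Lemma in_interior_of_side_forms (a : qparams) (q : pt) : convex_quad a ->
  (forall k, (k < 4)%nat -> side_form a k q < 0) -> in_interior a q.
Proof.
intros h hq; destruct (convex_signs a h) as (s1 & s2 & _ & _).
pose proof (hq 0%nat ltac:(lia)) as f0; pose proof (hq 1%nat ltac:(lia)) as f1.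
pose proof (hq 2%nat ltac:(lia)) as f2; pose proof (hq 3%nat ltac:(lia)) as f3.
unfold side_form, edge, vertex in *; simpl in *; clear hq.
destruct q as [x y]; destruct (vB a) as [bx by'] eqn:EB; destruct (vD a) as [dx dy] eqn:ED.
unfold vA, vC in *; pts.
destruct (Rtotal_order y 0) as [hy | [hy | hy]].
- right; left; unfold in_open_triangle.
  assert (hdiv : forall z, z < 0 -> 0 < z / dy) by
    (intros z hz; replace (z / dy) with (- z / - dy) by (field; lra);
     apply Rdiv_lt_0_compat; lra).
  exists ((dy - x * dy + y * dx - y) / dy), ((x * dy - y * dx) / dy), (y / dy).
  rewrite ED; unfold vA, vC.
  split; [|split; [|split; [|split]]]; try (apply hdiv; nra).
  + field; lra.
  + apply pt_eq; pts; field; lra.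
- right; right; exists x; subst y; split; [nra|]. unfold vA, vC; apply pt_eq; pts; ring.
- left; unfold in_open_triangle.
  exists ((by' - x * by' + y * bx - y) / by'), (y / by'), ((x * by' - y * bx) / by').
  rewrite EB; unfold vA, vC.
  split; [|split; [|split; [|split]]]; try (apply Rdiv_lt_0_compat; nra).
  + field; lra.
  + apply pt_eq; pts; field; lra.
Qed.

(** Each side form is affine along the segment, nonpositive at both ends, and cannot vanish at both
    because [j <> k]. *)
Lemma segment_in_interior (a : qparams) (j k : nat) (p q : pt) (u : R) :
  convex_quad a -> (j < 4)%nat -> (k < 4)%nat -> j <> k ->
  on_open_side a j p -> on_open_side a k q -> 0 < u < 1 ->
  in_interior a (pcomb u p q).
Proof.
intros h hj hk hjk hp hq hu; apply in_interior_of_side_forms; auto.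
intros i hi; rewrite side_form_comb.
assert (side_form a i p <= 0 /\ side_form a i q <= 0 /\
        (side_form a i p < 0 \/ side_form a i q < 0)) as (hp' & hq' & hpq).
{ destruct (Nat.eq_dec j i) as [<- | hji].
  - rewrite (side_form_self a j p hp).
    pose proof (side_form_other a k j q h hk hj (not_eq_sym hjk) hq); lra.
  - pose proof (side_form_other a j i p h hj hi hji hp).
    destruct (Nat.eq_dec k i) as [<- | hki].
    + rewrite (side_form_self a k q hq); lra.
    + pose proof (side_form_other a k i q h hk hi hki hq); lra. }
destruct hpq; nra.
Qed.

(** * Billiard flow and time reversal *)

(* A bounce point together with the velocity with which it is left. *)
Record state : Type := St { lab : nat; pos : pt; vel : pt }.

Definition step (a : qparams) (s s' : state) : Prop :=
  (lab s < 4)%nat /\ (lab s' < 4)%nat /\ lab s <> lab s' /\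
  on_open_side a (lab s) (pos s) /\ on_open_side a (lab s') (pos s') /\
  (exists mu, 0 < mu /\ psub (pos s') (pos s) = pscale mu (vel s)) /\
  vel s' = reflect (edge a (lab s')) (vel s).

(* [dw] and [aw] record the sides the steps depart from and arrive at. *)
Inductive flow (a : qparams) : state -> list nat -> list nat -> state -> Prop :=
| flow_nil s : flow a s [] [] s
| flow_cons s s1 s' dw aw : step a s s1 -> flow a s1 dw aw s' ->
    flow a s (lab s :: dw) (lab s1 :: aw) s'.

Lemma flow_trans (a : qparams) (s s1 s2 : state) (dw aw dw' aw' : list nat) :
  flow a s dw aw s1 -> flow a s1 dw' aw' s2 -> flow a s (dw ++ dw') (aw ++ aw') s2.
Proof. induction 1; simpl; intros; auto; econstructor; eauto. Qed.

Lemma edge_nonzero (a : qparams) (k : nat) : convex_quad a -> (k < 4)%nat ->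
  0 < pdot (edge a k) (edge a k).
Proof.
intros h hk; destruct (convex_signs a h) as (s1 & s2 & s3 & s4).
assert (pos : forall e : pt, snd e <> 0 -> 0 < pdot e e).
{ intros [x y] hy; pts; pose proof (Rle_0_sqr x); pose proof (Rlt_0_sqr y hy).
  unfold Rsqr in *; lra. }
four k; apply pos; unfold edge, vertex, psub; simpl; unfold vA, vC in *; simpl in *; lra.
Qed.

Lemma reflect_involutive (e v : pt) : 0 < pdot e e -> reflect e (reflect e v) = v.
Proof. intro h; unfold reflect; apply pt_eq; pts; field; lra. Qed.

Lemma reflect_scale (e v : pt) (c : R) :
  reflect e (pscale c v) = pscale c (reflect e v).
Proof. unfold reflect, Rdiv; apply pt_eq; pts; ring. Qed.

(** [vel] is the velocity after the bounce. Time reversal leaves with the opposite of the velocity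
    before it, which is recovered by reflecting. *)
Definition reverse (a : qparams) (s : state) : state :=
  St (lab s) (pos s) (pscale (-1) (reflect (edge a (lab s)) (vel s))).

Lemma step_reverse (a : qparams) (s s' : state) : convex_quad a ->
  step a s s' -> step a (reverse a s') (reverse a s).
Proof.
intros h (hk & hk' & hkk & hq & hq' & (mu & hmu & hpq) & hv).
unfold step, reverse; simpl; repeat split; auto.
- exists mu; split; auto.
  rewrite hv, reflect_involutive by (apply edge_nonzero; auto).
  apply (f_equal (pscale (-1))) in hpq.
  transitivity (pscale (-1) (psub (pos s') (pos s))); [apply pt_eq; pts; ring|].
  rewrite hpq; apply pt_eq; pts; ring.
- rewrite hv, (reflect_involutive _ (vel s)) by (apply edge_nonzero; auto).
  now rewrite reflect_scale.
Qed.

Lemma flow_reverse (a : qparams) (s s' : state) (dw aw : list nat) : convex_quad a ->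
  flow a s dw aw s' -> flow a (reverse a s') (rev aw) (rev dw) (reverse a s).
Proof.
intros h; induction 1 as [s | s s1 s' dw aw hs _ IH]; [constructor|].
simpl; apply (flow_trans a _ (reverse a s1)); auto.
apply step_reverse in hs; auto.
exact (flow_cons a _ _ _ [] [] hs (flow_nil a _)).
Qed.

Lemma flow_states (a : qparams) (s s' : state) (dw aw : list nat) :
  flow a s dw aw s' ->
  exists f : nat -> state, f 0%nat = s /\ f (length dw) = s' /\
    forall i, (i < length dw)%nat -> step a (f i) (f (S i)) /\ nth i dw 0%nat = lab (f i).
Proof.
induction 1 as [s | s s1 s' dw aw hs _ (f & f0 & fn & hf)].
- exists (fun _ => s); simpl; repeat split; auto; lia.
- exists (fun i => match i with 0%nat => s | S i => f i end); simpl; split; [|split]; auto.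
  intros [|i] hi; [rewrite f0; auto | apply hf; lia].
Qed.

(** As the flow closes up, [f n = f 0], so cyclic neighbours of an index carry the same states as
    its neighbours along the flow. *)
Lemma periodic_path_of_flow (a : qparams) (s : state) (dw aw : list nat) :
  convex_quad a -> dw <> [] -> flow a s dw aw s -> has_periodic_path a dw.
Proof.
intros h hw hs; destruct (flow_states a s s dw aw hs) as (f & f0 & fn & hf).
assert (hn : (0 < length dw)%nat) by (destruct dw; simpl; [congruence | lia]).
unfold has_periodic_path; set (n := length dw) in *.
assert (hnext : forall i, (i < n)%nat ->
  f ((i + 1) mod n)%nat = f (S i) /\ ((i + 1) mod n < n)%nat).
{ intros i hi; split; [|apply Nat.mod_upper_bound; lia].
  destruct (Nat.eq_dec (i + 1) n) as [e | e].
  - rewrite e, Nat.Div0.mod_same, f0, <- fn; f_equal; lia.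
  - rewrite Nat.mod_small by lia; f_equal; lia. }
assert (hprev : forall i, (i < n)%nat ->
  f (S ((i + n - 1) mod n)) = f i /\ ((i + n - 1) mod n < n)%nat).
{ intros i hi; split; [|apply Nat.mod_upper_bound; lia].
  destruct i as [|i].
  - rewrite Nat.mod_small by lia; rewrite f0, <- fn; f_equal; lia.
  - replace (S i + n - 1)%nat with (i + 1 * n)%nat by lia.
    rewrite Nat.Div0.mod_add, Nat.mod_small by lia; auto. }
split; [exact hn|split].
- apply Forall_forall; intros k hk; apply (In_nth _ _ 0%nat) in hk.
  destruct hk as (i & hi & <-); destruct (hf i hi) as (hst & ->); apply hst.
- exists (fun i => pos (f i)); intros i hi; simpl.
  destruct (hf i hi) as (hst & hlab).
  destruct (hnext i hi) as (en & ln); destruct (hprev i hi) as (ep & lp).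
  destruct (hf _ ln) as (_ & hlabn); destruct (hf _ lp) as (hstp & _).
  rewrite hlab, hlabn, en; rewrite ep in hstp.
  destruct hst as (k1 & k2 & kk & q1 & q2 & (mu & hmu & e1) & e2).
  destruct hstp as (_ & _ & _ & _ & _ & (mu' & hmu' & e1') & e2').
  split; [exact q1|split; [exact kk|split]].
  + intros u hu; apply (segment_in_interior a (lab (f i)) (lab (f (S i)))); auto.
  (* The incoming displacement is [mu'] times a velocity whose reflection is [vel (f i)], and the
     outgoing one is [mu] times [vel (f i)]. *)
  + exists (mu / mu'); split; [apply Rdiv_lt_0_compat; auto|].
    change (psub (vertex a (S (lab (f i)))) (vertex a (lab (f i)))) with (edge a (lab (f i))).
    rewrite e1, e1', reflect_scale, <- e2'; apply pt_eq; pts; field; lra.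
Qed.

(* A trajectory fixed by time reversal at both ends retraces itself. *)
Lemma periodic_path_of_reversible_flow (a : qparams) (s s' : state) (dw aw : list nat) :
  convex_quad a -> dw <> [] -> flow a s dw aw s' ->
  reverse a s = s -> reverse a s' = s' -> has_periodic_path a (dw ++ rev aw).
Proof.
intros h hw hs e e'.
pose proof (flow_reverse a s s' dw aw h hs) as hr; rewrite e, e' in hr.
(* On the way back, arrivals become departures, in reverse order. *)
apply (periodic_path_of_flow a s _ (aw ++ rev dw) h).
- destruct dw; simpl; congruence.
- exact (flow_trans _ _ _ _ _ _ _ _ hs hr).
Qed.

(** * Steps in rotated and mirrored frames *)

(* Unit vector at angle [th] in a frame rotated by [om], and mirrored when [sg = -1]. *)
Definition dir (sg om th : R) : pt := (cos (om + th), sg * sin (om + th)).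
Definition ray (sg om : R) (H : pt) (u th : R) : pt := padd H (pscale u (dir sg om th)).

(* The side [k] is the segment of length [p] from [H] in direction [be]; [et = 1]
   when the interior lies clockwise of that direction in the frame [(sg, om)]. *)
Definition side_from (a : qparams) (sg om : R) (k : nat) (H : pt) (be p et : R) : Prop :=
  (k < 4)%nat /\ 0 < p /\
  ((et * sg = 1 /\ vertex a k = H /\ vertex a (S k) = ray sg om H p be) \/
   (et * sg = -1 /\ vertex a k = ray sg om H p be /\ vertex a (S k) = H)).

Definition sign (x : R) : Prop := x = 1 \/ x = -1.

Lemma cross_dir (sg om x y : R) : cross (dir sg om x) (dir sg om y) = sg * sin (y - x).
Proof.
replace (y - x) with ((om + y) - (om + x)) by ring.
unfold dir; pts; rewrite sin_minus; ring.
Qed.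

Lemma dir_unit (sg om x : R) : sign sg -> pdot (dir sg om x) (dir sg om x) = 1.
Proof.
intros hs; unfold dir; pts; pose proof (sin2_cos2 (om + x)) as e; unfold Rsqr in e.
destruct hs; subst sg; lra.
Qed.

Lemma reflect_dir (sg om be th c : R) : sign sg -> c <> 0 ->
  reflect (pscale c (dir sg om be)) (dir sg om th) = dir sg om (2 * be - th).
Proof.
intros hs hc; unfold reflect.
replace (pdot (pscale c (dir sg om be)) (pscale c (dir sg om be))) with (c * c)
  by (transitivity (c * c * pdot (dir sg om be) (dir sg om be));
      [rewrite dir_unit by auto; ring | pts; ring]).
unfold dir; replace (om + (2 * be - th)) with ((om + be) + ((om + be) - (om + th))) by ring.
generalize (om + be) (om + th); intros x y.
rewrite sin_plus, cos_plus, sin_minus, cos_minus.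
pose proof (sin2_cos2 x) as e; unfold Rsqr in e.
set (S1 := sin x) in *; set (C1 := cos x) in *.
set (S2 := sin y); set (C2 := cos y).
assert (e' : S1 * S1 = 1 - C1 * C1) by lra.
apply pt_eq; pts; destruct hs; subst sg; field [e']; auto.
Qed.

Lemma side_edge (a : qparams) (sg om : R) (k : nat) (H : pt) (be p et : R) : sign sg ->
  side_from a sg om k H be p et -> edge a k = pscale (et * sg * p) (dir sg om be) /\ sign (et * sg).
Proof.
intros hs (_ & _ & [(e & e1 & e2) | (e & e1 & e2)]); unfold edge; rewrite e, e1, e2; split;
unfold sign; auto; unfold ray; apply pt_eq; pts; ring.
Qed.

Lemma Rdiv_lt_1 (x y : R) : 0 < y -> x < y -> x / y < 1.
Proof.
intros hy hx; apply (Rmult_lt_reg_r y); auto.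
unfold Rdiv; rewrite Rmult_assoc, Rinv_l; lra.
Qed.

Lemma side_point (a : qparams) (sg om : R) (k : nat) (H : pt) (be p et u : R) :
  side_from a sg om k H be p et -> 0 < u < p -> on_open_side a k (ray sg om H u be).
Proof.
intros (_ & hp & [(_ & e1 & e2) | (_ & e1 & e2)]) hu; unfold on_open_side; rewrite e1, e2.
- exists (u / p); split; [|unfold ray; apply pt_eq; pts; field; lra].
  split; [apply Rdiv_lt_0_compat; lra | apply Rdiv_lt_1; lra].
- exists (1 - u / p); split; [|unfold ray; apply pt_eq; pts; field; lra].
  assert (0 < u / p) by (apply Rdiv_lt_0_compat; lra).
  assert (u / p < 1) by (apply Rdiv_lt_1; lra). lra.
Qed.

(** The last hypothesis says that the displacement has no component across the direction [th], so it
    is a multiple [mu] of the velocity. The target lies strictly on the inner side of [k], where the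
    velocity points as well, hence [mu > 0]. *)
Lemma step_between (a : qparams) (sg om : R) (k k' : nat) (H H' : pt)
    (be be' p p' et et' g ga u u' th : R) :
  convex_quad a -> sign sg ->
  side_from a sg om k H be p et -> side_from a sg om k' H' be' p' et' ->
  H' = ray sg om H g ga -> k <> k' -> 0 < u < p -> 0 < u' < p' ->
  et * sin (th - be) < 0 ->
  g * sin (ga - th) + u' * sin (be' - th) = u * sin (be - th) ->
  step a (St k (ray sg om H u be) (dir sg om th))
         (St k' (ray sg om H' u' be') (dir sg om (2 * be' - th))).
Proof.
intros h hs f f' eH hk hu hu' hin hz.
pose proof (side_point a sg om k H be p et u f hu) as q.
pose proof (side_point a sg om k' H' be' p' et' u' f' hu') as q'.
destruct (side_edge a sg om k H be p et hs f) as (e & _).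
destruct (side_edge a sg om k' H' be' p' et' hs f') as (e' & se').
pose proof (side_form_other a k' k _ h (proj1 f') (proj1 f) (not_eq_sym hk) q') as neg.
pose proof (side_form_self a k _ q) as zero.
unfold side_form in neg, zero.
set (Q := ray sg om H u be) in *; set (Q' := ray sg om H' u' be') in *.
set (T := dir sg om th) in *.
assert (hcr : cross T (psub Q' Q) = 0).
{ transitivity (g * cross T (dir sg om ga) + u' * cross T (dir sg om be')
                - u * cross T (dir sg om be)).
  - unfold Q', Q; rewrite eH; unfold ray; pts; ring.
  - unfold T; rewrite !cross_dir.
    transitivity (sg * (g * sin (ga - th) + u' * sin (be' - th) - u * sin (be - th))); [ring|].
    rewrite hz; ring. }
pose proof (dir_unit sg om th hs) as hT; fold T in hT.
(* A vector is the sum of its components along and across the unit vector [T], and the second one is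
   zero. *)
assert (hQ : psub Q' Q = pscale (pdot T (psub Q' Q)) T).
{ apply pt_eq.
  - transitivity (fst (psub Q' Q) * pdot T T + snd T * cross T (psub Q' Q));
      [rewrite hT, hcr; ring | pts; ring].
  - transitivity (snd (psub Q' Q) * pdot T T - fst T * cross T (psub Q' Q));
      [rewrite hT, hcr; ring | pts; ring]. }
set (mu := pdot T (psub Q' Q)) in *.
unfold step; simpl; repeat split; auto; try apply f; try apply f'.
- exists mu; split; auto.
  assert (hneg : cross (edge a k) (psub Q' Q) < 0).
  { replace (cross _ _) with
      (cross (edge a k) (psub Q' (vertex a k)) - cross (edge a k) (psub Q (vertex a k)))
      by (pts; ring). lra. }
  rewrite hQ, e in hneg.
  replace (cross _ _) with (et * sg * p * mu * cross (dir sg om be) T) in hneg by (pts; ring).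
  unfold T in hneg; rewrite cross_dir in hneg.
  replace (et * sg * p * mu * (sg * sin (th - be)))
    with (sg * sg * (p * mu * (et * sin (th - be)))) in hneg by ring.
  replace (sg * sg) with 1 in hneg by (destruct hs; subst sg; ring).
  assert (hp : 0 < p) by apply f.
  destruct (Rle_or_lt mu 0) as [hm | hm]; auto. exfalso.
  assert (0 <= p * - mu * - (et * sin (th - be))); [|nra].
  apply Rmult_le_pos; [apply Rmult_le_pos|]; lra.
- rewrite e'; unfold T; rewrite reflect_dir; auto.
  assert (0 < p') by apply f'. destruct se' as [-> | ->]; lra.
Qed.

(** * Elementary bounds and perpendicular bounces *)

Lemma sin_le_id (x : R) : 0 <= x -> sin x <= x.
Proof.
intros [h | <-]; [left; apply sin_lt_x; auto | rewrite sin_0; lra].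
Qed.

(** From [cos x = 1 - 2 sin^2 (x / 2)] and the bound of the sine by its argument. *)
Lemma cos_ge (x : R) : 1 - x * x / 2 <= cos x.
Proof.
assert (pos : forall y, 0 <= y <= 1 -> sin y * sin y <= y * y).
{ intros y hy; pose proof (sin_le_id y (proj1 hy)).
  assert (0 <= sin y) by (apply sin_ge_0; pose proof PI2_1; lra). nra. }
assert (all : forall y, 0 <= y -> sin y * sin y <= y * y).
{ intros y hy; destruct (Rle_or_lt y 1); [apply pos; lra|].
  pose proof (SIN_bound y). nra. }
assert (h : sin (x / 2) * sin (x / 2) <= x / 2 * (x / 2)).
{ destruct (Rle_or_lt 0 x); [apply all; lra|].
  replace (x / 2) with (- (- x / 2)) by field; rewrite sin_neg.
  pose proof (all (- x / 2) ltac:(lra)). nra. }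
replace x with (2 * (x / 2)) at 3 by field; rewrite cos_2a_sin. nra.
Qed.

Lemma dir_period (sg om x y : R) : x = y + 2 * PI -> dir sg om x = dir sg om y.
Proof.
intros ->; unfold dir; replace (om + (y + 2 * PI)) with ((om + y) + 2 * PI) by ring.
rewrite sin_plus, cos_plus, sin_2PI, cos_2PI; apply pt_eq; simpl; ring.
Qed.

Lemma dir_antipode (sg om x y : R) : x = y + PI -> dir sg om x = pscale (-1) (dir sg om y).
Proof.
intros ->; unfold dir; replace (om + (y + PI)) with ((om + y) + PI) by ring.
rewrite neg_sin, neg_cos; apply pt_eq; pts; ring.
Qed.

(** The two alternatives are the two directions perpendicular to the side; the mirror image of each
    is its opposite. *)
Lemma reverse_perpendicular (a : qparams) (sg om : R) (k : nat) (H : pt) (be p et th : R) (q : pt) :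
  sign sg -> side_from a sg om k H be p et -> 2 * be - th = th + PI \/ th = 2 * be - th + PI ->
  reverse a (St k q (dir sg om th)) = St k q (dir sg om th).
Proof.
intros hs f e; destruct (side_edge a sg om k H be p et hs f) as (ee & se).
unfold reverse; simpl; f_equal.
assert (hp : 0 < p) by apply f.
rewrite ee, reflect_dir by (auto; destruct se as [-> | ->]; lra).
destruct e as [e | e]; [rewrite (dir_antipode sg om (2 * be - th) th e) |
  rewrite (dir_antipode sg om th (2 * be - th) e)]; apply pt_eq; pts; ring.
Qed.

(** * Paths on three sides around two adjacent vertices *)

(* [A] and [D = ray A l 0] are adjacent vertices with interior angles [PI / 2 - e] and
   [PI / 2 + d]; [k3] is the side [AD], and [k0], [k2] are the other sides at [A], [D]. *)
Record corner (a : qparams) (sg om : R) (k0 k2 k3 : nat) (A : pt) (e d l p q : R) : Prop := {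
  corner_convex : convex_quad a;
  corner_sign : sign sg;
  corner_side0 : side_from a sg om k0 A (PI / 2 - e) p 1;
  corner_side2 : side_from a sg om k2 (ray sg om A l 0) (PI / 2 - d) q (-1);
  corner_side3 : side_from a sg om k3 A 0 l (-1);
  corner_02 : k0 <> k2;
  corner_03 : k0 <> k3;
  corner_23 : k2 <> k3;
  corner_p : 93 / 100 * l <= p;
  corner_q : 93 / 100 * l <= q }.

(* Trajectories crossing from [k0] to [k2] have angle [r], those crossing back have angle
   [PI - s]. Their distances from [A] and [D] are [l * al] and [l * be]; in these
   coordinates a bounce keeps [al] or [be], and the slopes obey [s = r + 2 * d] on [k2],
   [r = s - 2 * e] on [k0] and change sign on [k3]. *)
Definition leave0 (sg om : R) (k0 : nat) (A : pt) (e l al r : R) : state :=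
  St k0 (ray sg om A (l * al / cos (r + e)) (PI / 2 - e)) (dir sg om r).
Definition leave2 (sg om : R) (k2 : nat) (A : pt) (d l be s : R) : state :=
  St k2 (ray sg om (ray sg om A l 0) (l * be / cos (s - d)) (PI / 2 - d)) (dir sg om (PI - s)).

(** The bounds keep bounces on their sides: small angles have cosine at least 23/25, and 3/4 divided
    by 23/25 is less than the 93/100 of [corner]. *)
Definition small (x : R) : Prop := - (3 / 8) <= x <= 3 / 8.
Definition admissible (x : R) : Prop := 0 < x <= 3 / 4.

Lemma cos_small (x : R) : small x -> 23 / 25 <= cos x.
Proof. intro h; unfold small in h; pose proof (cos_ge x). nra. Qed.

Lemma distance_admissible (l p al x : R) : 0 < l -> 93 / 100 * l <= p -> admissible al -> small x ->
  0 < l * al / cos x < p.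
Proof.
intros hl hp (ha & ha') hx; pose proof (cos_small x hx).
split; [apply Rdiv_lt_0_compat; nra|].
apply (Rmult_lt_reg_r (cos x)); [lra|].
unfold Rdiv; rewrite Rmult_assoc, Rinv_l by lra. nra.
Qed.

Lemma sin_lt (x y : R) : -1 <= x -> x < y -> y <= 1 -> sin x < sin y.
Proof. intros; pose proof PI2_1; apply sin_increasing_1; lra. Qed.

Lemma sin_pos (x : R) : 0 < x -> x <= 1 -> 0 < sin x.
Proof. intros; rewrite <- sin_0; apply sin_lt; lra. Qed.

Lemma sin_range (x : R) : 0 < x -> x <= 1 -> 0 < sin x <= x.
Proof. intros; split; [apply sin_pos | apply sin_le_id]; lra. Qed.

Ltac sin_bounds x := destruct (sin_range x ltac:(lra) ltac:(lra)).

Lemma sin_sub (x y : R) : sin x - sin y = 2 * cos ((x + y) / 2) * sin ((x - y) / 2).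
Proof. rewrite form4; ring. Qed.

Lemma sin_add (x y : R) : sin x + sin y = 2 * cos ((x - y) / 2) * sin ((x + y) / 2).
Proof. rewrite form3; ring. Qed.

Lemma exists_between (L P K : R) : 0 < P -> 0 < K -> L < P -> L < K ->
  exists x, 0 < x /\ L < x /\ x < P /\ x < K.
Proof.
intros; exists ((Rmax 0 L + Rmin P K) / 2).
unfold Rmax, Rmin; destruct (Rle_dec 0 L), (Rle_dec P K); lra.
Qed.

Section Corner.
Variables (a : qparams) (sg om : R) (k0 k2 k3 : nat) (A : pt) (e d l p q : R).
Hypothesis c : corner a sg om k0 k2 k3 A e d l p q.

Let L0 := leave0 sg om k0 A e l.
Let L2 := leave2 sg om k2 A d l.

Lemma corner_l : 0 < l.
Proof. apply (corner_side3 _ _ _ _ _ _ _ _ _ _ _ _ c). Qed.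

Lemma corner_back : A = ray sg om (ray sg om A l 0) l PI.
Proof.
unfold ray, dir; rewrite Rplus_0_r, neg_sin, neg_cos; apply pt_eq; pts; ring.
Qed.

(** The trajectory deviates by [r + e] and [s - d] from the normals of [k0] and [k2]. The cosines of
    these deviations cancel the denominators of [leave0] and [leave2] in the alignment equation,
    leaving [be = al + sin r]. *)
Lemma step_right (al be r s : R) : admissible al -> admissible be -> small (r + e) -> small (s - d) ->
  s = r + 2 * d -> be = al + sin r ->
  step a (leave0 sg om k0 A e l al r) (leave2 sg om k2 A d l be s).
Proof.
intros ha hb hr hs es eb; pose proof corner_l as hl; destruct c as [c1 c2 c3 c4 c5 c6 c7 c8 c9 c10].
pose proof (cos_small _ hr); pose proof (cos_small _ hs).
unfold leave0, leave2.
replace (PI - s) with (2 * (PI / 2 - d) - r) by lra.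
apply (step_between a sg om k0 k2 A _ (PI / 2 - e) (PI / 2 - d) p q 1 (-1) l 0); auto;
  try (apply distance_admissible; auto).
- replace (r - (PI / 2 - e)) with (- (PI / 2 - (r + e))) by ring.
  rewrite sin_neg, sin_shift; lra.
- replace (PI / 2 - d - r) with (PI / 2 - (s - d)) by lra.
  replace (PI / 2 - e - r) with (PI / 2 - (r + e)) by lra.
  rewrite !sin_shift, Rminus_0_l, sin_neg, eb; field; lra.
Qed.

Lemma step_left (al be r s : R) : admissible al -> admissible be -> small (r + e) -> small (s - d) ->
  r = s - 2 * e -> al = be + sin s ->
  step a (leave2 sg om k2 A d l be s) (leave0 sg om k0 A e l al r).
Proof.
intros ha hb hr hs er ea; pose proof corner_l as hl; destruct c as [c1 c2 c3 c4 c5 c6 c7 c8 c9 c10].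
pose proof (cos_small _ hr); pose proof (cos_small _ hs).
unfold leave0, leave2.
replace r with (2 * (PI / 2 - e) - (PI - s)) at 2 by lra.
apply (step_between a sg om k2 k0 _ A (PI / 2 - d) (PI / 2 - e) q p (-1) 1 l PI); auto;
  try (apply distance_admissible; auto); try apply corner_back.
- replace (PI - s - (PI / 2 - d)) with (PI / 2 - (s - d)) by field.
  rewrite sin_shift; lra.
- replace (PI / 2 - e - (PI - s)) with (- (PI / 2 - (r + e))) by lra.
  replace (PI / 2 - d - (PI - s)) with (- (PI / 2 - (s - d))) by lra.
  replace (PI - (PI - s)) with s by ring.
  rewrite !sin_neg, !sin_shift, ea; field; lra.
Qed.

(** Without [k3] the trajectory would pass [A] at the negative height [be + sin s] with slope [s];
    the bounce changes both signs. The condition [0 < al] means that [k3] is hit before [A]. *)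
Lemma flow_bottom (al be r s : R) (dw aw : list nat) (t : state) :
  flow a (leave0 sg om k0 A e l al r) dw aw t ->
  admissible al -> admissible be -> small (r + e) -> small (s - d) ->
  r = - s - 2 * e -> al = - sin s - be -> sin s < 0 ->
  flow a (leave2 sg om k2 A d l be s) (k2 :: k3 :: dw) (k3 :: k0 :: aw) t.
Proof.
intros hf ha hb hr hs er ea hpos; pose proof corner_l as hl.
destruct c as [c1 c2 c3 c4 c5 c6 c7 c8 c9 c10].
pose proof (cos_small _ hr); pose proof (cos_small _ hs).
(* The bounce on [k3] divides [AD] in the ratio [al : be]. *)
assert (hx : 0 < l + l * be / sin s < l).
{ destruct ha, hb. replace (l + l * be / sin s) with (l * al / - sin s) by (subst al; field; lra).
  assert (0 < l * al) by nra. assert (0 < l * be) by nra.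
  split; [apply Rdiv_lt_0_compat; lra|].
  apply (Rmult_lt_reg_r (- sin s)); [lra|].
  unfold Rdiv; rewrite Rmult_assoc, Rinv_l by lra. subst al; nra. }
refine (flow_cons a (leave2 sg om k2 A d l be s)
  (St k3 (ray sg om A (l + l * be / sin s) 0) (dir sg om (2 * 0 - (PI - s))))
  t (k3 :: dw) (k0 :: aw) _ _).
{ unfold leave2.
  apply (step_between a sg om k2 k3 _ A (PI / 2 - d) 0 q l (-1) (-1) l PI); auto;
    try (apply distance_admissible; auto); try apply corner_back.
  - replace (PI - s - (PI / 2 - d)) with (PI / 2 - (s - d)) by field.
    rewrite sin_shift; lra.
  - replace (PI / 2 - d - (PI - s)) with (- (PI / 2 - (s - d))) by lra.
    replace (PI - (PI - s)) with s by ring.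
    replace (0 - (PI - s)) with (- (PI - s)) by ring.
    rewrite !sin_neg, !sin_shift, sin_PI_x; field; lra. }
refine (flow_cons a (St k3 _ _) (leave0 sg om k0 A e l al r) t dw aw _ hf).
unfold leave0.
(* The two reflections produce the direction [r] only up to a full turn. *)
rewrite <- (dir_period sg om (2 * (PI / 2 - e) - (2 * 0 - (PI - s))) r) by lra.
apply (step_between a sg om k3 k0 A A 0 (PI / 2 - e) l p (-1) 1 0 0); auto;
  try (apply distance_admissible; auto).
- unfold ray; apply pt_eq; pts; ring.
- replace (2 * 0 - (PI - s) - 0) with (- (PI - s)) by ring.
  rewrite sin_neg, sin_PI_x; lra.
- replace (0 - (2 * 0 - (PI - s))) with (PI - s) by ring.
  replace (PI / 2 - e - (2 * 0 - (PI - s))) with (PI / 2 - - (r + e) + PI) by (subst r; field).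
  rewrite neg_sin, sin_shift, cos_neg, sin_PI_x, er, ea; field; split; try lra.
  rewrite er in *; lra.
Qed.

Lemma flow_right (al be r s : R) (dw aw : list nat) (t : state) :
  flow a (L2 be s) dw aw t ->
  admissible al -> admissible be -> small (r + e) -> small (s - d) -> s = r + 2 * d -> be = al + sin r ->
  flow a (L0 al r) (k0 :: dw) (k2 :: aw) t.
Proof.
intros hf; intros.
refine (flow_cons a (L0 al r) (L2 be s) t dw aw _ hf).
apply step_right; auto.
Qed.

Lemma flow_left (al be r s : R) (dw aw : list nat) (t : state) :
  flow a (L0 al r) dw aw t ->
  admissible al -> admissible be -> small (r + e) -> small (s - d) -> r = s - 2 * e -> al = be + sin s ->
  flow a (L2 be s) (k2 :: dw) (k0 :: aw) t.
Proof.
intros hf; intros.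
refine (flow_cons a (L2 be s) (L0 al r) t dw aw _ hf).
apply step_left; auto.
Qed.

(** Here, and for [s = d] on [k2], the deviation from the normal is zero. *)
Lemma reverse_leave0 (al : R) : reverse a (L0 al (- e)) = L0 al (- e).
Proof.
destruct c; apply (reverse_perpendicular a sg om k0 A (PI / 2 - e) p 1); auto; left; field.
Qed.

Lemma reverse_leave2 (be : R) : reverse a (L2 be d) = L2 be d.
Proof.
destruct c; apply (reverse_perpendicular a sg om k2 (ray sg om A l 0) (PI / 2 - d) q (-1)); auto.
right; field.
Qed.

Definition mirror_flow (dw aw : list nat) : Prop :=
  exists s t, flow a s dw aw t /\ reverse a s = s /\ reverse a t = t.

Lemma mirror_flow_path (dw aw : list nat) : dw <> [] ->
  mirror_flow dw aw -> has_periodic_path a (dw ++ rev aw).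
Proof.
intros hw (s & t & hf & hs & ht).
apply (periodic_path_of_reversible_flow a s t); auto; apply c.
Qed.

Ltac side :=
  unfold admissible, small; repeat split;
  try lra.

(** The sides [k0] and [k2] are parallel, so a common perpendicular is traced back and forth; its
    height 1/2 is arbitrary within the admissible range. *)
Lemma path_rectangle : e = 0 -> d = 0 -> has_periodic_path a [k0; k2].
Proof.
intros e0 d0.
apply (mirror_flow_path [k0] [k2]); [congruence|].
exists (L0 (1 / 2) (- e)), (L2 (1 / 2) d); split; [|split].
- pose proof sin_0; apply (flow_right _ (1 / 2) _ d); [constructor|side ..].
  rewrite e0, Ropp_0; lra.
- apply reverse_leave0.
- apply reverse_leave2.
Qed.

Hypothesis he : 0 < e < 1 / 16.

Lemma path_right : d = 0 -> has_periodic_path a [k0; k2; k3; k0; k3; k2].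
Proof.
intros d0.
apply (mirror_flow_path [k0; k2; k3] [k2; k3; k0]); [congruence|].
(* Any height on [k2] strictly between 0 and [sin e] keeps both heights around the bounce on [k3]
   positive; the middle one is taken, here and in the next two paths. *)
exists (L0 (3 / 2 * sin e) (- e)), (L0 (1 / 2 * sin e) (- e)).
split; [|split]; try apply reverse_leave0.
sin_bounds e; pose proof (sin_neg e).
apply (flow_right _ (1 / 2 * sin e) _ (- e)); [|side ..].
apply (flow_bottom (1 / 2 * sin e) _ (- e)); [constructor|side ..].
Qed.

(** Leaving [k2] perpendicularly, the slopes are [d], [d - 2 * e] and [3 * d - 2 * e]. The last one
    is [- e] exactly when [e = 3 * d], and the bounce on [k3] then leads perpendicularly into
    [k0]. *)
Lemma path_third : e = 3 * d -> has_periodic_path a [k2; k0; k2; k3; k0; k3; k2; k0].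
Proof.
intros ed.
apply (mirror_flow_path [k2; k0; k2; k3] [k0; k2; k3; k0]); [congruence|].
set (x := 1 / 2 * sin e).
exists (L2 (x + sin (2 * e - d) - sin d) d), (L0 x (- e)).
split; [|split]; [|apply reverse_leave2|apply reverse_leave0].
sin_bounds e; pose proof (sin_neg e).
sin_bounds (2 * e - d); sin_bounds d.
pose proof (sin_lt d (2 * e - d) ltac:(lra) ltac:(lra) ltac:(lra)).
assert (sin (d - 2 * e) = - sin (2 * e - d)) by (rewrite <- sin_neg; f_equal; ring).
apply (flow_left (x + sin (2 * e - d)) _ (d - 2 * e)); [|unfold x; side ..].
apply (flow_right _ x _ (- e)); [|unfold x; side ..].
apply (flow_bottom x _ (- e)); [constructor|unfold x; side ..].
Qed.

(** The slopes are [- e], [0], [- 2 * e], and then [2 * d - 2 * e = - e], which the bounce on [k3]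
    turns into the perpendicular slope at [k0]. *)
Lemma path_half : e = 2 * d ->
  has_periodic_path a [k0; k2; k0; k2; k3; k0; k3; k2; k0; k2].
Proof.
intros ed.
apply (mirror_flow_path [k0; k2; k0; k2; k3] [k2; k0; k2; k3; k0]); [congruence|].
set (x := 1 / 2 * sin e).
exists (L0 (x + sin (2 * e) + sin e) (- e)), (L0 x (- e)).
split; [|split]; try apply reverse_leave0.
sin_bounds e; pose proof (sin_neg e).
sin_bounds (2 * e).
assert (sin (- (2 * e)) = - sin (2 * e)) by apply sin_neg.
apply (flow_right _ (x + sin (2 * e)) _ 0); [|unfold x; side ..].
apply (flow_left (x + sin (2 * e)) _ (- (2 * e))); [|unfold x; side; rewrite ?sin_0; lra ..].
apply (flow_right _ x _ (- e)); [|unfold x; side ..].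
apply (flow_bottom x _ (- e)); [constructor|unfold x; side ..].
Qed.

(* [x] is the height above [D] just before the first bounce on [k3] and [K - x] the one just
   before the second; every height is positive as soon as [K - sin e < x < K] and
   [0 < x < sin (3 * e - 4 * d)]. Sum-to-product formulas turn the compatibility of these
   constraints into [0 < e - 3 * d] and [0 < d]. *)
Lemma path_below_third : 0 < d -> 3 * d < e ->
  has_periodic_path a ([k0; k2; k0; k2; k3; k0; k2; k0; k2; k3] ++
                       [k0; k3; k2; k0; k2; k0; k3; k2; k0; k2]).
Proof.
intros d0 ed.
apply (mirror_flow_path [k0; k2; k0; k2; k3; k0; k2; k0; k2; k3]
        [k2; k0; k2; k3; k0; k2; k0; k2; k3; k0]); [congruence|].
set (K := sin (3 * e - 4 * d) + sin (e - 4 * d) + sin (e - 2 * d) - sin (e + 2 * d)).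
assert (hK : 0 < K).
(* Grouped so that both pairs have the factor [sin (e - 3 * d)]. *)
{ replace K with ((sin (3 * e - 4 * d) - sin (e + 2 * d)) + (sin (e - 4 * d) + sin (e - 2 * d)))
    by (unfold K; ring).
  rewrite sin_sub, sin_add.
  replace ((3 * e - 4 * d - (e + 2 * d)) / 2) with (e - 3 * d) by field.
  replace ((e - 4 * d + (e - 2 * d)) / 2) with (e - 3 * d) by field.
  sin_bounds (e - 3 * d).
  pose proof (cos_small ((3 * e - 4 * d + (e + 2 * d)) / 2) ltac:(unfold small; lra)).
  pose proof (cos_small ((e - 4 * d - (e - 2 * d)) / 2) ltac:(unfold small; lra)).
  nra. }
sin_bounds e; pose proof (sin_neg e).
sin_bounds (3 * e - 4 * d).
sin_bounds (e - 2 * d).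
sin_bounds (3 * e - 2 * d).
pose proof (sin_lt (e - 4 * d) e ltac:(lra) ltac:(lra) ltac:(lra)); pose proof (sin_lt (e - 2 * d) (e + 2 * d) ltac:(lra) ltac:(lra) ltac:(lra)).
destruct (exists_between (K - sin e) (sin (3 * e - 4 * d)) K) as (x & x0 & x1 & x2 & x3);
  [unfold K in *; lra ..|].
exists (L0 (x + sin (3 * e - 2 * d) + sin (e - 2 * d) + sin e) (- e)), (L0 (sin e - (K - x)) (- e)).
split; [|split]; try apply reverse_leave0.
unfold K in *; clear K.
assert (sin (2 * d - e) = - sin (e - 2 * d)) by (rewrite <- sin_neg; f_equal; ring).
assert (sin (2 * d - 3 * e) = - sin (3 * e - 2 * d)) by (rewrite <- sin_neg; f_equal; ring).
assert (sin (4 * d - 3 * e) = - sin (3 * e - 4 * d)) by (rewrite <- sin_neg; f_equal; ring).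
assert (sin (- (e + 2 * d)) = - sin (e + 2 * d)) by apply sin_neg.
(* The slopes are [- e], [2 * d - e], [2 * d - 3 * e], [4 * d - 3 * e], then after the first bounce
   on [k3] they are [e - 4 * d], [e - 2 * d], [- (e + 2 * d)], [- e], and after the second [- e]
   again. The heights add up the sines. *)
apply (flow_right _ (x + sin (3 * e - 2 * d) + sin (e - 2 * d)) _ (2 * d - e)); [|side ..].
apply (flow_left (x + sin (3 * e - 2 * d)) _ (2 * d - 3 * e)); [|side ..].
apply (flow_right _ x _ (4 * d - 3 * e)); [|side ..].
apply (flow_bottom (sin (3 * e - 4 * d) - x) _ (e - 4 * d)); [|side ..].
apply (flow_right _ (sin (3 * e - 4 * d) - x + sin (e - 4 * d)) _ (e - 2 * d)); [|side ..].
apply (flow_left (sin (3 * e - 4 * d) - x + sin (e - 4 * d) + sin (e - 2 * d)) _ (- (e + 2 * d)));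
  [|side ..].
apply (flow_right _ (sin (3 * e - 4 * d) - x + sin (e - 4 * d) + sin (e - 2 * d) - sin (e + 2 * d))
         _ (- e)); [|side ..].
match goal with |- flow _ _ _ _ (L0 ?y _) => apply (flow_bottom y _ (- e)) end;
  [constructor|side ..].
Qed.

(* As before, with the constraints [K - sin e < x < K] and [0 < x < sin (5 * e - 6 * d)],
   which are compatible because of [0 < e - 2 * d] and [0 < 3 * d - e]. *)
Lemma path_above_third : e < 3 * d -> 2 * d < e ->
  has_periodic_path a ([k0; k2; k0; k2; k0; k2; k3; k0; k2; k0; k2; k0; k2; k3] ++
                       [k0; k3; k2; k0; k2; k0; k2; k0; k3; k2; k0; k2; k0; k2]).
Proof.
intros d0 ed.
apply (mirror_flow_path [k0; k2; k0; k2; k0; k2; k3; k0; k2; k0; k2; k0; k2; k3]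
        [k2; k0; k2; k0; k2; k3; k0; k2; k0; k2; k0; k2; k3; k0]); [congruence|].
set (K := sin (5 * e - 6 * d) + sin (3 * e - 6 * d) + sin (3 * e - 4 * d) +
          sin (e - 4 * d) + sin (e - 2 * d) - sin (e + 2 * d)).
sin_bounds e; pose proof (sin_neg e).
sin_bounds (5 * e - 6 * d).
sin_bounds (3 * e - 6 * d).
sin_bounds (3 * e - 4 * d).
sin_bounds (e - 2 * d).
sin_bounds (5 * e - 4 * d).
sin_bounds (3 * e - 2 * d).
assert (hK : 0 < K).
(* Both pairs have the factor [sin (2 * e - 4 * d)], and the remaining sines are positive. *)
{ replace K with ((sin (5 * e - 6 * d) - sin (e + 2 * d)) +
     (sin (3 * e - 4 * d) + sin (e - 4 * d)) + sin (3 * e - 6 * d) + sin (e - 2 * d))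
    by (unfold K; ring).
  rewrite sin_sub, sin_add.
  replace ((5 * e - 6 * d - (e + 2 * d)) / 2) with (2 * e - 4 * d) by field.
  replace ((3 * e - 4 * d + (e - 4 * d)) / 2) with (2 * e - 4 * d) by field.
  sin_bounds (2 * e - 4 * d).
  pose proof (cos_small ((5 * e - 6 * d + (e + 2 * d)) / 2) ltac:(unfold small; lra)).
  pose proof (cos_small ((3 * e - 4 * d - (e - 4 * d)) / 2) ltac:(unfold small; lra)).
  nra. }
(* With the comparisons below this gives [K - sin e < sin (5 * e - 6 * d)]. *)
assert (hd : sin (e - 4 * d) + sin (e - 2 * d) < 0).
{ rewrite sin_add.
  replace ((e - 4 * d + (e - 2 * d)) / 2) with (- (3 * d - e)) by field; rewrite sin_neg.
  sin_bounds (3 * d - e).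
  pose proof (cos_small ((e - 4 * d - (e - 2 * d)) / 2) ltac:(unfold small; lra)).
  nra. }
pose proof (sin_lt (e - 2 * d) (e + 2 * d) ltac:(lra) ltac:(lra) ltac:(lra)).
pose proof (sin_lt (3 * e - 6 * d) e ltac:(lra) ltac:(lra) ltac:(lra)); pose proof (sin_lt (3 * e - 4 * d) (e + 2 * d) ltac:(lra) ltac:(lra) ltac:(lra)).
destruct (exists_between (K - sin e) (sin (5 * e - 6 * d)) K) as (x & x0 & x1 & x2 & x3);
  [unfold K in *; lra ..|].
exists (L0 (x + sin (5 * e - 4 * d) + sin (3 * e - 4 * d) + sin (3 * e - 2 * d) +
            sin (e - 2 * d) + sin e) (- e)), (L0 (sin e - (K - x)) (- e)).
split; [|split]; try apply reverse_leave0.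
unfold K in *; clear K.
assert (sin (2 * d - e) = - sin (e - 2 * d)) by (rewrite <- sin_neg; f_equal; ring).
assert (sin (2 * d - 3 * e) = - sin (3 * e - 2 * d)) by (rewrite <- sin_neg; f_equal; ring).
assert (sin (4 * d - 3 * e) = - sin (3 * e - 4 * d)) by (rewrite <- sin_neg; f_equal; ring).
assert (sin (4 * d - 5 * e) = - sin (5 * e - 4 * d)) by (rewrite <- sin_neg; f_equal; ring).
assert (sin (6 * d - 5 * e) = - sin (5 * e - 6 * d)) by (rewrite <- sin_neg; f_equal; ring).
assert (sin (- (e + 2 * d)) = - sin (e + 2 * d)) by apply sin_neg.
apply (flow_right _ (x + sin (5 * e - 4 * d) + sin (3 * e - 4 * d) + sin (3 * e - 2 * d) +
            sin (e - 2 * d)) _ (2 * d - e)); [|side ..].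
apply (flow_left (x + sin (5 * e - 4 * d) + sin (3 * e - 4 * d) + sin (3 * e - 2 * d))
         _ (2 * d - 3 * e)); [|side ..].
apply (flow_right _ (x + sin (5 * e - 4 * d) + sin (3 * e - 4 * d)) _ (4 * d - 3 * e)); [|side ..].
apply (flow_left (x + sin (5 * e - 4 * d)) _ (4 * d - 5 * e)); [|side ..].
apply (flow_right _ x _ (6 * d - 5 * e)); [|side ..].
apply (flow_bottom (sin (5 * e - 6 * d) - x) _ (3 * e - 6 * d)); [|side ..].
set (y := sin (5 * e - 6 * d) - x) in *.
apply (flow_right _ (y + sin (3 * e - 6 * d)) _ (3 * e - 4 * d)); [|unfold y; side ..].
apply (flow_left (y + sin (3 * e - 6 * d) + sin (3 * e - 4 * d)) _ (e - 4 * d));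
  [|unfold y; side ..].
apply (flow_right _ (y + sin (3 * e - 6 * d) + sin (3 * e - 4 * d) + sin (e - 4 * d))
         _ (e - 2 * d)); [|unfold y; side ..].
apply (flow_left (y + sin (3 * e - 6 * d) + sin (3 * e - 4 * d) + sin (e - 4 * d) + sin (e - 2 * d))
         _ (- (e + 2 * d))); [|unfold y; side ..].
apply (flow_right _ (y + sin (3 * e - 6 * d) + sin (3 * e - 4 * d) + sin (e - 4 * d) +
         sin (e - 2 * d) - sin (e + 2 * d)) _ (- e)); [|unfold y; side ..].
match goal with |- flow _ _ _ _ (L0 ?y _) => apply (flow_bottom y _ (- e)) end;
  [constructor|unfold y; side ..].
Qed.
End Corner.

(** The bounce on [k0] is at distance [l * sin e] from [A], the foot of the perpendicular from [D];
    likewise on [k2] at distance [l * sin f] from [D]. The orthic path closes after three bounces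
    and is doubled to get an even word. *)
Lemma path_fagnano (a : qparams) (sg om : R) (k0 k2 k3 : nat) (A : pt) (e d l p q : R) :
  corner a sg om k0 k2 k3 A e d l p q -> 0 < e < 1 / 16 -> 0 < - d < 1 / 16 ->
  has_periodic_path a [k0; k2; k3; k0; k2; k3].
Proof.
intros c he hd; set (f := - d) in *.
assert (ed : d = - f) by (unfold f; ring); clearbody f.
sin_bounds e; sin_bounds f.
pose proof (COS_bound e); pose proof (COS_bound f).
pose proof (cos_small e ltac:(unfold small; lra)).
pose proof (cos_small f ltac:(unfold small; lra)).
set (s := leave0 sg om k0 A e l (sin e * cos f) (f - e)).
assert (hs : flow a s [k0; k2; k3] [k2; k3; k0] s).
{ assert (admissible (sin e * cos f)) by (unfold admissible; nra).
  assert (admissible (sin f * cos e)) by (unfold admissible; nra).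
  apply (flow_right a sg om k0 k2 k3 A e d l p q c _ (sin f * cos e) _ (- (e + f)));
    auto; try (unfold small; lra).
  - apply (flow_bottom a sg om k0 k2 k3 A e d l p q c (sin e * cos f) _ (f - e));
      auto; try (unfold small; lra); [constructor| |].
    + rewrite sin_neg, sin_plus; ring.
    + rewrite sin_neg; sin_bounds (e + f); lra.
  - rewrite sin_minus; ring. }
apply (periodic_path_of_flow a s _ ([k2; k3; k0] ++ [k2; k3; k0]));
  [apply c | congruence | exact (flow_trans _ _ _ _ _ _ _ _ hs hs)].
Qed.

(** * Paths for two opposite acute vertices *)

(** With [h] and [h'] the distances of [H] and [H'] from the trajectory, and [s] and [s'] the sines
    of its angles with the sides, the alignment equation becomes linear in the distances. *)
Lemma step_heights (a : qparams) (sg om : R) (k k' : nat) (H H' : pt)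
    (be be' p p' et et' g ga h h' s s' th th' : R) :
  convex_quad a -> sign sg ->
  side_from a sg om k H be p et -> side_from a sg om k' H' be' p' et' ->
  H' = ray sg om H g ga -> k <> k' -> 0 < s /\ 0 < h / s < p -> 0 < s' /\ 0 < h' / s' < p' ->
  sign et -> sin (be - th) = et * s -> sin (be' - th) = - (et' * s') ->
  g * sin (ga - th) = et * h + et' * h' -> th' = 2 * be' - th ->
  step a (St k (ray sg om H (h / s) be) (dir sg om th))
         (St k' (ray sg om H' (h' / s') be') (dir sg om th')).
Proof.
intros hc hs f f' eH hk (hs1 & hu) (hs2 & hu') het e1 e2 e3 ->.
apply (step_between a sg om k k' H H' be be' p p' et et' g ga); auto.
- replace (th - be) with (- (be - th)) by ring.
  rewrite sin_neg, e1; destruct het; subst et; lra.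
- rewrite e1, e2, e3; field; lra.
Qed.

(** By the addition formula [p * sin (x + y)] is at least (3/10)(99/100) g - (4/5)(1/8) g, which
    exceeds g/8 and so [h]. *)
Lemma distance_spread (g p h x y : R) : 0 < g -> 0 < p -> 3 / 10 * g <= p * sin x ->
  - (4 / 5 * g) <= p * cos x <= 4 / 5 * g -> 0 < h <= g / 16 -> - (1 / 8) <= y <= 1 / 8 ->
  0 < sin (x + y) /\ 0 < h / sin (x + y) < p.
Proof.
intros hg hp hs hc hh hy.
assert (hps : g / 8 <= p * sin (x + y)).
{ rewrite sin_plus.
  replace (p * (sin x * cos y + cos x * sin y)) with (p * sin x * cos y + p * cos x * sin y) by ring.
  assert (99 / 100 <= cos y) by (pose proof (cos_ge y); nra).
  assert (- (1 / 8) <= sin y <= 1 / 8).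
  { destruct (Rle_or_lt 0 y).
    - pose proof (sin_le_id y). assert (0 <= sin y) by (apply sin_ge_0; pose proof PI2_1; lra). lra.
    - replace y with (- - y) by ring; rewrite sin_neg.
      pose proof (sin_range (- y) ltac:(lra) ltac:(lra)). lra. }
  assert (- (1 / 10 * g) <= p * cos x * sin y) by nra. nra. }
assert (hsin : 0 < sin (x + y)).
{ destruct (Rle_or_lt (sin (x + y)) 0); auto; exfalso; nra. }
split; [auto|split]; [apply Rdiv_lt_0_compat; lra|].
apply (Rmult_lt_reg_r (sin (x + y))); [lra|].
unfold Rdiv; rewrite Rmult_assoc, Rinv_l by lra. nra.
Qed.

(* Keeps the far end of a side away from trajectories almost parallel to the diagonal. *)
Definition spread (g p x : R) : Prop :=
  0 < p /\ 3 / 10 * g <= p * sin x /\ - (4 / 5 * g) <= p * cos x <= 4 / 5 * g.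

Lemma sin_minus_PI (x : R) : sin (x - PI) = - sin x.
Proof. rewrite sin_minus, sin_PI, cos_PI; ring. Qed.

Lemma sin_minus_2PI (x : R) : sin (x - 2 * PI) = sin x.
Proof. rewrite sin_minus, sin_2PI, cos_2PI; ring. Qed.

(* In the unfolding, the copies of [A] and [C] are joined by four copies of the diagonal whose
   angles with the translation are [f - e], [- (e + f)], [e - f], [e + f]. So each bounce
   is at distance [g sin e cos f] from [A] or [g sin f cos e] from [C], measured across
   the trajectory. *)
Lemma path_opposite (a : qparams) (sg om : R) (k0 k1 k2 k3 : nat) (A C : pt)
    (x1 x2 x3 x4 p0 p1 p2 p3 g e f : R) :
  convex_quad a -> sign sg ->
  side_from a sg om k0 A x1 p0 1 -> side_from a sg om k1 C (PI - x2) p1 (-1) ->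
  side_from a sg om k2 C (PI + x3) p2 1 -> side_from a sg om k3 A (- x4) p3 (-1) ->
  NoDup [k0; k1; k2; k3] -> C = ray sg om A g 0 -> 0 < g ->
  x1 + x4 = PI / 2 - e -> x2 + x3 = PI / 2 - f -> 0 < e < 1 / 16 -> 0 < f < 1 / 16 ->
  spread g p0 x1 -> spread g p1 x2 -> spread g p2 x3 -> spread g p3 x4 ->
  has_periodic_path a [k0; k1; k2; k0; k3; k2; k1; k3].
Proof.
intros hc hs f0 f1 f2 f3 hk HC hg ee ef he hf h1 h2 h3 h4.
assert (hneq : k0 <> k1 /\ k0 <> k2 /\ k0 <> k3 /\ k1 <> k2 /\ k1 <> k3 /\ k2 <> k3).
{ repeat match goal with H : NoDup (_ :: _) |- _ => inversion_clear H end.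
  simpl in *; repeat split; intro; subst; tauto. }
destruct hneq as (n01 & n02 & n03 & n12 & n13 & n23).
assert (HA : A = ray sg om C g PI).
{ rewrite HC; unfold ray, dir; rewrite Rplus_0_r, neg_sin, neg_cos; apply pt_eq; pts; ring. }
assert (same : forall H, H = ray sg om H 0 0) by (intro; unfold ray; apply pt_eq; pts; ring).
set (h := g * (sin e * cos f)); set (k := g * (sin f * cos e)).
sin_bounds e; sin_bounds f.
pose proof (COS_bound e); pose proof (COS_bound f).
pose proof (cos_small e ltac:(unfold small; lra)).
pose proof (cos_small f ltac:(unfold small; lra)).
assert (hh : 0 < h <= g / 16).
{ unfold h; assert (0 < sin e * cos f <= 1 / 16) by nra. nra. }
assert (hk' : 0 < k <= g / 16).
{ unfold k; assert (0 < sin f * cos e <= 1 / 16) by nra. nra. }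
assert (ok : forall p x y t, spread g p x -> 0 < t <= g / 16 ->
  - (1 / 8) <= y <= 1 / 8 -> 0 < sin (x + y) /\ 0 < t / sin (x + y) < p)
  by (intros p x y t (? & ? & ?) ht hy; apply (distance_spread g); auto).
(* The directions follow from one another by reflection, simplified with [x1 + x4 = PI / 2 - e] and
   [x2 + x3 = PI / 2 - f]. *)
set (s0 := St k0 (ray sg om A (h / sin (x1 + (e - f))) x1) (dir sg om (f - e))).
set (s1 := St k1 (ray sg om C (k / sin (x2 + (f - e))) (PI - x2)) (dir sg om (2 * PI - 2 * x2 - f + e))).
set (s2 := St k2 (ray sg om C (k / sin (x3 + (e + f))) (PI + x3)) (dir sg om (PI - (e + f)))).
set (s3 := St k0 (ray sg om A (h / sin (x1 + (e + f))) x1) (dir sg om (2 * x1 - PI + e + f))).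
set (s4 := St k3 (ray sg om A (h / sin (x4 + (e - f))) (- x4)) (dir sg om (e - f))).
set (s5 := St k2 (ray sg om C (k / sin (x3 + (f - e))) (PI + x3)) (dir sg om (2 * PI + 2 * x3 - e + f))).
set (s6 := St k1 (ray sg om C (k / sin (x2 + (e + f))) (PI - x2)) (dir sg om (e + f - PI))).
set (s7 := St k3 (ray sg om A (h / sin (x4 + (e + f))) (- x4)) (dir sg om (PI - 2 * x4 - (e + f)))).
(* Between sides at different vertices, alignment is the addition formula for [sin (e - f)] or
   [sin (e + f)]; between the two sides at one vertex, the equal heights cancel. *)
assert (t0 : step a s0 s1).
{ apply (step_heights a sg om k0 k1 A C x1 (PI - x2) p0 p1 1 (-1) g 0); auto;
    try (apply ok; auto; lra); try (left; reflexivity); try lra.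
  - rewrite Rmult_1_l; f_equal; ring.
  - replace (PI - x2 - (f - e)) with (PI - (x2 + (f - e))) by ring; rewrite sin_PI_x; ring.
  - replace (0 - (f - e)) with (e - f) by ring; rewrite sin_minus; unfold h, k; ring. }
assert (t1 : step a s1 s2).
{ apply (step_heights a sg om k1 k2 C C (PI - x2) (PI + x3) p1 p2 (-1) 1 0 0); auto;
    try (apply ok; auto; lra); try (right; reflexivity); try lra.
  - replace (PI - x2 - (2 * PI - 2 * x2 - f + e)) with (x2 + (f - e) - PI) by ring.
    rewrite sin_minus_PI; ring.
  - replace (PI + x3 - (2 * PI - 2 * x2 - f + e)) with (- (x3 + (e + f))) by lra.
    rewrite sin_neg; ring. }
assert (t2 : step a s2 s3).
{ apply (step_heights a sg om k2 k0 C A (PI + x3) x1 p2 p0 1 1 g PI); auto;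
    try (apply ok; auto; lra); try (left; reflexivity); try lra.
  - rewrite Rmult_1_l; f_equal; ring.
  - replace (x1 - (PI - (e + f))) with (x1 + (e + f) - PI) by ring; rewrite sin_minus_PI; ring.
  - replace (PI - (PI - (e + f))) with (e + f) by ring; rewrite sin_plus; unfold h, k; ring. }
assert (t3 : step a s3 s4).
{ apply (step_heights a sg om k0 k3 A A x1 (- x4) p0 p3 1 (-1) 0 0); auto;
    try (apply ok; auto; lra); try (left; reflexivity); try lra.
  - replace (x1 - (2 * x1 - PI + e + f)) with (PI - (x1 + (e + f))) by ring; rewrite sin_PI_x; ring.
  - replace (- x4 - (2 * x1 - PI + e + f)) with (x4 + (e - f)) by lra; ring. }
assert (t4 : step a s4 s5).
{ apply (step_heights a sg om k3 k2 A C (- x4) (PI + x3) p3 p2 (-1) 1 g 0); auto;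
    try (apply ok; auto; lra); try (right; reflexivity); try lra.
  - replace (- x4 - (e - f)) with (- (x4 + (e - f))) by ring; rewrite sin_neg; ring.
  - replace (PI + x3 - (e - f)) with (x3 + (f - e) + PI) by ring; rewrite neg_sin; ring.
  - replace (0 - (e - f)) with (f - e) by ring; rewrite sin_minus; unfold h, k; ring. }
assert (t5 : step a s5 s6).
{ apply (step_heights a sg om k2 k1 C C (PI + x3) (PI - x2) p2 p1 1 (-1) 0 0); auto;
    try (apply ok; auto; lra); try (left; reflexivity); try lra.
  - replace (PI + x3 - (2 * PI + 2 * x3 - e + f)) with (- (x3 + (f - e) + PI)) by ring.
    rewrite sin_neg, neg_sin; ring.
  - replace (PI - x2 - (2 * PI + 2 * x3 - e + f)) with (x2 + (e + f) - 2 * PI) by lra.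
    rewrite sin_minus_2PI; ring. }
assert (t6 : step a s6 s7).
{ apply (step_heights a sg om k1 k3 C A (PI - x2) (- x4) p1 p3 (-1) (-1) g PI); auto;
    try (apply ok; auto; lra); try (right; reflexivity); try lra.
  - replace (PI - x2 - (e + f - PI)) with (- (x2 + (e + f) - 2 * PI)) by ring.
    rewrite sin_neg, sin_minus_2PI; ring.
  - replace (- x4 - (e + f - PI)) with (PI - (x4 + (e + f))) by ring; rewrite sin_PI_x; ring.
  - replace (PI - (e + f - PI)) with (- (e + f - 2 * PI)) by ring.
    rewrite sin_neg, sin_minus_2PI, sin_plus; unfold h, k; ring. }
assert (t7 : step a s7 s0).
{ apply (step_heights a sg om k3 k0 A A (- x4) x1 p3 p0 (-1) 1 0 0); auto;
    try (apply ok; auto; lra); try (right; reflexivity); try lra.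
  - replace (- x4 - (PI - 2 * x4 - (e + f))) with (x4 + (e + f) - PI) by ring.
    rewrite sin_minus_PI; ring.
  - replace (x1 - (PI - 2 * x4 - (e + f))) with (- (x1 + (e - f))) by lra.
    rewrite sin_neg; ring. }
apply (periodic_path_of_flow a s0 _ [k1; k2; k0; k3; k2; k1; k3; k0]); auto; [congruence|].
exact (flow_cons a s0 s1 _ _ _ t0 (flow_cons a s1 s2 _ _ _ t1 (flow_cons a s2 s3 _ _ _ t2
  (flow_cons a s3 s4 _ _ _ t3 (flow_cons a s4 s5 _ _ _ t4 (flow_cons a s5 s6 _ _ _ t5
  (flow_cons a s6 s7 _ _ _ t6 (flow_cons a s7 s0 _ _ _ t7 (flow_nil a s0))))))))).
Qed.

(** Otherwise [cos (167 / 100)] would be nonnegative, but its Taylor polynomial of degree 4, an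
    upper bound, is negative. The bound must be below 107/32 for [eps_lt]. *)
Lemma PI_lt : PI < 167 / 50.
Proof.
destruct (Rlt_or_le PI (167 / 50)) as [h | h]; auto; exfalso.
assert (0 <= cos (167 / 100)) by (apply cos_ge_0; pose proof PI_RGT_0; lra).
destruct (pre_cos_bound (167 / 100) 0) as [_ hb]; try lra.
unfold cos_approx, cos_term in hb; simpl in hb. lra.
Qed.

(** * The sides seen from their ends, and the eight corners *)

Lemma side0_A a sg om be et : in_Q a -> et * sg = 1 ->
  dir sg om be = (cos (a1 a), sin (a1 a)) -> side_from a sg om 0 vA be (len0 a) et.
Proof.
intros h hs hd; split; [lia|split; [apply len_pos; auto|]]; left.
unfold ray; rewrite hd; repeat split; auto; apply vB_polar.
Qed.

Lemma side0_B a sg om be et : in_Q a -> et * sg = -1 ->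
  dir sg om be = (- cos (a1 a), - sin (a1 a)) -> side_from a sg om 0 (vB a) be (len0 a) et.
Proof.
intros h hs hd; split; [lia|split; [apply len_pos; auto|]]; right.
unfold ray; rewrite hd; repeat split; auto.
change (vA = padd (vB a) (pscale (len0 a) (- cos (a1 a), - sin (a1 a)))).
rewrite vB_polar; apply pt_eq; pts; ring.
Qed.

Lemma side1_B a sg om be et : in_Q a -> et * sg = 1 ->
  dir sg om be = (cos (a2 a), - sin (a2 a)) -> side_from a sg om 1 (vB a) be (len1 a) et.
Proof.
intros h hs hd; split; [lia|split; [apply len_pos; auto|]]; left.
unfold ray; rewrite hd; repeat split; auto; apply vC_vB; auto.
Qed.

Lemma side1_C a sg om be et : in_Q a -> et * sg = -1 ->
  dir sg om be = (- cos (a2 a), sin (a2 a)) -> side_from a sg om 1 vC be (len1 a) et.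
Proof.
intros h hs hd; split; [lia|split; [apply len_pos; auto|]]; right.
unfold ray; rewrite hd; repeat split; auto.
change (vB a = padd vC (pscale (len1 a) (- cos (a2 a), sin (a2 a)))).
rewrite (vC_vB a h); apply pt_eq; pts; ring.
Qed.

Lemma side2_C a sg om be et : in_Q a -> et * sg = 1 ->
  dir sg om be = (- cos (a3 a), - sin (a3 a)) -> side_from a sg om 2 vC be (len2 a) et.
Proof.
intros h hs hd; split; [lia|split; [apply len_pos; auto|]]; left.
unfold ray; rewrite hd; repeat split; auto.
change (vD a = padd vC (pscale (len2 a) (- cos (a3 a), - sin (a3 a)))).
rewrite (vC_vD a h); apply pt_eq; pts; ring.
Qed.

Lemma side2_D a sg om be et : in_Q a -> et * sg = -1 ->
  dir sg om be = (cos (a3 a), sin (a3 a)) -> side_from a sg om 2 (vD a) be (len2 a) et.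
Proof.
intros h hs hd; split; [lia|split; [apply len_pos; auto|]]; right.
unfold ray; rewrite hd; repeat split; auto; apply vC_vD; auto.
Qed.

Lemma side3_D a sg om be et : in_Q a -> et * sg = 1 ->
  dir sg om be = (- cos (a4 a), sin (a4 a)) -> side_from a sg om 3 (vD a) be (len3 a) et.
Proof.
intros h hs hd; split; [lia|split; [apply len_pos; auto|]]; left.
unfold ray; rewrite hd; repeat split; auto.
change (vA = padd (vD a) (pscale (len3 a) (- cos (a4 a), sin (a4 a)))).
rewrite vD_polar; apply pt_eq; pts; ring.
Qed.

Lemma side3_A a sg om be et : in_Q a -> et * sg = -1 ->
  dir sg om be = (cos (a4 a), - sin (a4 a)) -> side_from a sg om 3 vA be (len3 a) et.
Proof.
intros h hs hd; split; [lia|split; [apply len_pos; auto|]]; right.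
unfold ray; rewrite hd; repeat split; auto; apply vD_polar.
Qed.

Definition balanced (a : qparams) : Prop :=
  convex_quad a /\
  forall x y, In x [len0 a; len1 a; len2 a; len3 a] -> In y [len0 a; len1 a; len2 a; len3 a] ->
    93 / 100 * x <= y.

Ltac angle X :=
  unfold dir; replace (_ + _) with X by field;
  rewrite ?sin_minus, ?cos_minus, ?sin_neg, ?cos_neg, ?sin_PI, ?cos_PI;
  apply pt_eq; simpl; ring.

(** Seeing [k3] from both of its ends identifies [D] with [ray sg om A l 0]. *)
Lemma corner_of_sides a sg om k0 k2 k3 A D e d l p q : balanced a -> sign sg ->
  side_from a sg om k0 A (PI / 2 - e) p 1 -> side_from a sg om k2 D (PI / 2 - d) q (-1) ->
  side_from a sg om k3 A 0 l (-1) -> side_from a sg om k3 D PI l 1 ->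
  NoDup [k0; k2; k3] -> In l [len0 a; len1 a; len2 a; len3 a] ->
  In p [len0 a; len1 a; len2 a; len3 a] -> In q [len0 a; len1 a; len2 a; len3 a] ->
  corner a sg om k0 k2 k3 A e d l p q.
Proof.
intros (hc & hb) hs f0 f2 f3 f3' hk hl hp hq.
assert (HD : D = ray sg om A l 0).
{ destruct f3 as (_ & _ & [(e1 & v1 & v2) | (e1 & v1 & v2)]);
  destruct f3' as (_ & _ & [(e1' & v1' & v2') | (e1' & v1' & v2')]); try lra;
  congruence. }
subst D.
repeat match goal with H : NoDup (_ :: _) |- _ => inversion_clear H end; simpl in *.
constructor; auto; intro; subst; tauto.
Qed.


(** The angles at [B] and [D] are [PI] minus a sum of parameters, which reverses the signs in
    [acuteB] and [acuteD]. *)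
Definition acuteA a := PI / 2 - a1 a - a4 a.
Definition acuteB a := a1 a + a2 a - PI / 2.
Definition acuteC a := PI / 2 - a2 a - a3 a.
Definition acuteD a := a3 a + a4 a - PI / 2.

Ltac solve_corner :=
  intros hb; pose proof (proj1 (proj1 hb)) as h; eapply corner_of_sides; eauto;
  [unfold sign; lra | | | | |repeat constructor; simpl; intuition lia | simpl; auto 6 ..].

(** In these eight names the first letter is the vertex with acuteness [e] and the second its
    neighbour with acuteness [- d]. The rotation [om] gives the side between them direction 0, and
    the mirrored frame serves the four pairs in the other sense of rotation. *)
Lemma corner_AD a : balanced a ->
  corner a 1 (- a4 a) 0 2 3 vA (acuteA a) (- acuteD a) (len3 a) (len0 a) (len2 a).
Proof.
solve_corner.
- apply side0_A; auto; [lra|]. unfold acuteA; angle (a1 a).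
- apply side2_D; auto; [lra|]. unfold acuteD; angle (a3 a).
- apply side3_A; auto; [lra|]. angle (- a4 a).
- apply side3_D; auto; [lra|]. angle (PI - a4 a).
Qed.

Lemma corner_BA a : balanced a ->
  corner a 1 (a1 a - PI) 1 3 0 (vB a) (acuteB a) (- acuteA a) (len0 a) (len1 a) (len3 a).
Proof.
solve_corner.
- apply side1_B; auto; [lra|]. unfold acuteB; angle (- a2 a).
- apply side3_A; auto; [lra|]. unfold acuteA; angle (- a4 a).
- apply side0_B; auto; [lra|]. angle (a1 a - PI).
- apply side0_A; auto; [lra|]. angle (a1 a).
Qed.

Lemma corner_CB a : balanced a ->
  corner a 1 (PI - a2 a) 2 0 1 vC (acuteC a) (- acuteB a) (len1 a) (len2 a) (len0 a).
Proof.
solve_corner.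
- apply side2_C; auto; [lra|]. unfold acuteC; replace (PI / 2 - (PI / 2 - a2 a - a3 a)) with (a2 a + a3 a) by ring.
  unfold dir; replace (PI - a2 a + (a2 a + a3 a)) with (a3 a + PI) by ring.
  rewrite neg_sin, neg_cos; apply pt_eq; simpl; ring.
- apply side0_B; auto; [lra|]. unfold acuteB, dir.
  replace (PI - a2 a + (PI / 2 - - (a1 a + a2 a - PI / 2))) with (a1 a + PI) by field.
  rewrite neg_sin, neg_cos; apply pt_eq; simpl; ring.
- apply side1_C; auto; [lra|]. angle (PI - a2 a).
- apply side1_B; auto; [lra|]. unfold dir.
  replace (PI - a2 a + PI) with (- a2 a + 2 * PI) by ring.
  rewrite sin_plus, cos_plus, sin_2PI, cos_2PI, sin_neg, cos_neg; apply pt_eq; simpl; ring.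
Qed.

Lemma corner_DC a : balanced a ->
  corner a 1 (a3 a) 3 1 2 (vD a) (acuteD a) (- acuteC a) (len2 a) (len3 a) (len1 a).
Proof.
solve_corner.
- apply side3_D; auto; [lra|]. unfold acuteD; angle (PI - a4 a).
- apply side1_C; auto; [lra|]. unfold acuteC; angle (PI - a2 a).
- apply side2_D; auto; [lra|]. unfold dir; rewrite Rplus_0_r, Rmult_1_l; auto.
- apply side2_C; auto; [lra|]. unfold dir; rewrite neg_sin, neg_cos; apply pt_eq; simpl; ring.
Qed.

Lemma corner_AB a : balanced a ->
  corner a (-1) (- a1 a) 3 1 0 vA (acuteA a) (- acuteB a) (len0 a) (len3 a) (len1 a).
Proof.
solve_corner.
- apply side3_A; auto; [lra|]. unfold acuteA; angle (a4 a).
- apply side1_B; auto; [lra|]. unfold acuteB; angle (a2 a).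
- apply side0_A; auto; [lra|]. angle (- a1 a).
- apply side0_B; auto; [lra|]. angle (PI - a1 a).
Qed.

Lemma corner_BC a : balanced a ->
  corner a (-1) (a2 a) 0 2 1 (vB a) (acuteB a) (- acuteC a) (len1 a) (len0 a) (len2 a).
Proof.
solve_corner.
- apply side0_B; auto; [lra|]. unfold acuteB; angle (PI - a1 a).
- apply side2_C; auto; [lra|]. unfold acuteC; angle (PI - a3 a).
- apply side1_B; auto; [lra|]. unfold dir; rewrite Rplus_0_r; apply pt_eq; simpl; ring.
- apply side1_C; auto; [lra|]. unfold dir; rewrite neg_sin, neg_cos; apply pt_eq; simpl; ring.
Qed.

Lemma corner_CD a : balanced a ->
  corner a (-1) (PI - a3 a) 1 3 2 vC (acuteC a) (- acuteD a) (len2 a) (len1 a) (len3 a).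
Proof.
solve_corner.
- apply side1_C; auto; [lra|]. unfold acuteC, dir.
  replace (PI - a3 a + (PI / 2 - (PI / 2 - a2 a - a3 a))) with (a2 a + PI) by field.
  rewrite neg_sin, neg_cos; apply pt_eq; simpl; ring.
- apply side3_D; auto; [lra|]. unfold acuteD, dir.
  replace (PI - a3 a + (PI / 2 - - (a3 a + a4 a - PI / 2))) with (a4 a + PI) by field.
  rewrite neg_sin, neg_cos; apply pt_eq; simpl; ring.
- apply side2_C; auto; [lra|]. angle (PI - a3 a).
- apply side2_D; auto; [lra|]. unfold dir.
  replace (PI - a3 a + PI) with (- a3 a + 2 * PI) by ring.
  rewrite sin_plus, cos_plus, sin_2PI, cos_2PI, sin_neg, cos_neg; apply pt_eq; simpl; ring.
Qed.

Lemma corner_DA a : balanced a ->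
  corner a (-1) (a4 a - PI) 2 0 3 (vD a) (acuteD a) (- acuteA a) (len3 a) (len2 a) (len0 a).
Proof.
solve_corner.
- apply side2_D; auto; [lra|]. unfold acuteD; angle (- a3 a).
- apply side0_A; auto; [lra|]. unfold acuteA; angle (- a1 a).
- apply side3_D; auto; [lra|]. angle (a4 a - PI).
- apply side3_A; auto; [lra|]. angle (a4 a).
Qed.

(** * Estimates near the square *)

Lemma eps_lt : PI / 107 < 1 / 32.
Proof. pose proof PI_lt; lra. Qed.

Definition near_quarter (u : R) : Prop := - (1 / 32) < u - PI / 4 < 1 / 32.

(** For [u = PI / 4 + x] the two products are [cos x + sin x] and [cos x - sin x], where [cos x] is
    at least 1 - (1/32)^2 / 2. *)
Lemma near_quarter_trig (u : R) : near_quarter u ->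
  968 / 1000 <= sqrt 2 * sin u <= 1032 / 1000 /\ 968 / 1000 <= sqrt 2 * cos u <= 1032 / 1000.
Proof.
unfold near_quarter; intros hu; set (x := u - PI / 4) in *.
replace u with (PI / 4 + x) by (unfold x; ring).
assert (h2 : sqrt 2 <> 0) by (apply Rgt_not_eq, sqrt_lt_R0; lra).
rewrite sin_plus, cos_plus, sin_PI4, cos_PI4.
replace (sqrt 2 * (1 / sqrt 2 * cos x + 1 / sqrt 2 * sin x)) with (cos x + sin x) by (field; auto).
replace (sqrt 2 * (1 / sqrt 2 * cos x - 1 / sqrt 2 * sin x)) with (cos x - sin x) by (field; auto).
assert (1 - 1 / 2048 <= cos x <= 1) by (split; [pose proof (cos_ge x); nra | apply COS_bound]).
assert (- (1 / 32) <= sin x <= 1 / 32).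
{ destruct (Rle_or_lt 0 x).
  - pose proof (sin_le_id x). assert (0 <= sin x) by (apply sin_ge_0; pose proof PI2_1; lra). lra.
  - replace x with (- - x) by ring; rewrite sin_neg.
    pose proof (sin_range (- x) ltac:(lra) ltac:(lra)). lra. }
lra.
Qed.

Lemma near_quarter_sin_sum (u v : R) : near_quarter u -> near_quarter v -> 998 / 1000 <= sin (u + v) <= 1.
Proof.
unfold near_quarter; intros; split; [|apply SIN_bound].
replace (u + v) with (PI / 2 - (PI / 2 - u - v)) by ring; rewrite sin_shift.
pose proof (cos_ge (PI / 2 - u - v)). nra.
Qed.

Lemma near_quarter_ratio (u v : R) : near_quarter u -> near_quarter v ->
  968 / 1000 <= sqrt 2 * (sin u / sin (u + v)) <= 1035 / 1000.
Proof.
intros hu hv; destruct (near_quarter_trig u hu) as [h _]; pose proof (near_quarter_sin_sum u v hu hv) as h'.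
replace (sqrt 2 * (sin u / sin (u + v))) with (sqrt 2 * sin u / sin (u + v)) by (field; lra).
split; apply (Rmult_le_reg_r (sin (u + v))); try lra;
replace (sqrt 2 * sin u / sin (u + v) * sin (u + v)) with (sqrt 2 * sin u) by (field; lra); nra.
Qed.

Section NearSquare.
Variable a : qparams.
Hypothesis h1 : near_quarter (a1 a).
Hypothesis h2 : near_quarter (a2 a).
Hypothesis h3 : near_quarter (a3 a).
Hypothesis h4 : near_quarter (a4 a).

Lemma near_convex : convex_quad a.
Proof.
pose proof PI2_1; pose proof PI_lt; unfold near_quarter in *.
unfold convex_quad, in_Q; repeat split; lra.
Qed.

Lemma near_len (x : R) : In x [len0 a; len1 a; len2 a; len3 a] ->
  968 / 1000 <= sqrt 2 * x <= 1035 / 1000.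
Proof.
unfold len0, len1, len2, len3; intros [<- | [<- | [<- | [<- | []]]]];
[rewrite Rplus_comm | | rewrite Rplus_comm | ]; apply near_quarter_ratio; auto.
Qed.

Lemma near_balanced : balanced a.
Proof.
split; [apply near_convex|]; intros x y hx hy.
pose proof (near_len x hx); pose proof (near_len y hy).
assert (0 < sqrt 2) by (apply sqrt_lt_R0; lra).
(* The quotient 968/1035 exceeds 93/100. *)
apply (Rmult_le_reg_l (sqrt 2)); auto; lra.
Qed.

Lemma near_product (x y : R) : 968 / 1000 <= sqrt 2 * x <= 1035 / 1000 ->
  968 / 1000 <= sqrt 2 * y <= 1032 / 1000 -> 46 / 100 <= x * y <= 54 / 100.
Proof.
intros; replace (x * y) with ((sqrt 2 * x) * (sqrt 2 * y) / (sqrt 2 * sqrt 2))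
  by (field; apply Rgt_not_eq, sqrt_lt_R0; lra).
rewrite sqrt_sqrt by lra; nra.
Qed.

Lemma near_vertices :
  46 / 100 <= len0 a * sin (a1 a) <= 54 / 100 /\ 46 / 100 <= len0 a * cos (a1 a) <= 54 / 100 /\
  46 / 100 <= len1 a * sin (a2 a) <= 54 / 100 /\ 46 / 100 <= len1 a * cos (a2 a) <= 54 / 100 /\
  46 / 100 <= len2 a * sin (a3 a) <= 54 / 100 /\ 46 / 100 <= len2 a * cos (a3 a) <= 54 / 100 /\
  46 / 100 <= len3 a * sin (a4 a) <= 54 / 100 /\ 46 / 100 <= len3 a * cos (a4 a) <= 54 / 100.
Proof.
repeat split; apply near_product; try (apply near_len; simpl; auto 6); apply near_quarter_trig; auto.
Qed.

Lemma path_AC : 0 < acuteA a < 1 / 16 -> 0 < acuteC a < 1 / 16 ->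
  has_periodic_path a [0; 1; 2; 0; 3; 2; 1; 3]%nat.
Proof.
intros hA hC; pose proof near_convex as hc; pose proof (proj1 hc) as h.
destruct near_vertices as (v1 & v2 & v3 & v4 & v5 & v6 & v7 & v8).
destruct (len_pos a h) as (l0 & l1 & l2 & l3).
apply (path_opposite a 1 0 0 1 2 3 vA vC (a1 a) (a2 a) (a3 a) (a4 a)
         (len0 a) (len1 a) (len2 a) (len3 a) 1 (acuteA a) (acuteC a)); auto;
  try (unfold spread; lra); try (unfold acuteA, acuteC; lra); try lra.
- left; auto.
- apply side0_A; auto; [lra|]. angle (a1 a).
- apply side1_C; auto; [lra|]. angle (PI - a2 a).
- apply side2_C; auto; [lra|]. unfold dir; replace (0 + (PI + a3 a)) with (a3 a + PI) by ring.
  rewrite neg_sin, neg_cos; apply pt_eq; simpl; ring.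
- apply side3_A; auto; [lra|]. angle (- a4 a).
- repeat constructor; simpl; intuition lia.
- unfold ray, dir; rewrite Rplus_0_r, sin_0, cos_0; apply pt_eq; unfold vA, vC; pts; ring.
Qed.

(** As [y < 0], the angle can be taken as minus an arc cosine. This puts the diagonal from [B] to
    [D] in polar form. *)
Lemma polar_down (x y : R) : y < 0 -> exists g om, 0 < g /\ x = g * cos om /\ y = g * sin om.
Proof.
intros hy; set (g := sqrt (x * x + y * y)).
assert (hs : 0 < x * x + y * y) by nra.
assert (hg : 0 < g) by (apply sqrt_lt_R0; auto).
assert (gg : g * g = x * x + y * y) by (apply sqrt_sqrt; lra).
assert (hx : -1 <= x / g <= 1).
{ assert (- g <= x <= g) by nra.
  split; apply (Rmult_le_reg_r g); auto; unfold Rdiv; rewrite Rmult_assoc, Rinv_l; lra. }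
exists g, (- acos (x / g)); split; auto.
rewrite cos_neg, sin_neg, cos_acos, sin_acos by auto; split; [field; lra|].
replace (1 - (x / g)²) with ((- y / g)²).
- rewrite sqrt_Rsqr; [field; lra|]. left; apply Rdiv_lt_0_compat; lra.
- unfold Rsqr; apply (Rmult_eq_reg_r (g * g)); [|nra]. field_simplify; [|lra..]. lra.
Qed.

Lemma path_BD : 0 < acuteB a < 1 / 16 -> 0 < acuteD a < 1 / 16 ->
  has_periodic_path a [1; 2; 3; 1; 0; 3; 2; 0]%nat.
Proof.
intros hB hD; pose proof near_convex as hc; pose proof (proj1 hc) as h.
destruct near_vertices as (v1 & v2 & v3 & v4 & v5 & v6 & v7 & v8).
destruct (len_pos a h) as (l0 & l1 & l2 & l3).
(* [(X, Y)] is the vector from [B] to [D]; the frame is turned by its angle [om], which is close to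
   [- PI / 2]. *)
set (X := len3 a * cos (a4 a) - len0 a * cos (a1 a)).
set (Y := - (len3 a * sin (a4 a) + len0 a * sin (a1 a))).
destruct (polar_down X Y) as (g & om & hg & eX & eY); [unfold Y; lra|].
assert (hX : - (8 / 100) <= g * cos om <= 8 / 100) by (rewrite <- eX; unfold X; lra).
assert (hY : - (108 / 100) <= g * sin om <= - (92 / 100)) by (rewrite <- eY; unfold Y; lra).
pose proof (sin2_cos2 om) as e1; unfold Rsqr in e1.
set (c := cos om) in *; set (s := sin om) in *.
assert (g1 : 92 / 100 <= g) by nra.
assert (g2 : g <= 109 / 100) by nra.
assert (hcs : - (9 / 100) <= c <= 9 / 100) by nra.
assert (hsn : -1 <= s <= - (99 / 100)) by nra.
(* Components along and across [BD] of a side whose coordinates are [x] and [y] up to sign. *)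
assert (rot : forall x y, 46 / 100 <= x <= 54 / 100 -> 46 / 100 <= y <= 54 / 100 ->
  3 / 10 * g <= - (s * x) - c * y /\ 3 / 10 * g <= - (s * x) + c * y /\
  - (4 / 5 * g) <= s * x + c * y <= 4 / 5 * g /\
  - (4 / 5 * g) <= s * x - c * y <= 4 / 5 * g).
{ intros x y hx hy.
  assert (- (54 / 100) <= s * x <= - (45 / 100)) by nra.
  assert (- (5 / 100) <= c * y <= 5 / 100) by nra. lra. }
apply (path_opposite a 1 om 1 2 3 0 (vB a) (vD a)
         (- a2 a - om) (om + PI - a3 a) (- a4 a - om) (om + PI - a1 a)
         (len1 a) (len2 a) (len3 a) (len0 a) g (acuteB a) (acuteD a)); auto;
  try (unfold acuteB, acuteD; lra); try lra.
- left; auto.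
- apply side1_B; auto; [lra|]. angle (- a2 a).
- apply side2_D; auto; [lra|]. angle (a3 a).
- apply side3_D; auto; [lra|]. angle (PI - a4 a).
- apply side0_B; auto; [lra|]. angle (a1 a - PI).
- repeat constructor; simpl; intuition lia.
- unfold ray, dir; rewrite Rplus_0_r; fold c s.
  rewrite vB_polar, vD_polar; apply pt_eq; unfold vA; pts; unfold X, Y in *; lra.
- unfold spread; rewrite sin_minus, cos_minus, sin_neg, cos_neg; fold c s.
  destruct (rot _ _ v3 v4) as (r1 & r2 & r3 & r4).
  destruct (rot _ _ v4 v3) as (q1 & q2 & q3 & q4).
  split; [auto|split]; lra.
- unfold spread; rewrite sin_minus, cos_minus, neg_sin, neg_cos; fold c s.
  destruct (rot _ _ v5 v6) as (r1 & r2 & r3 & r4).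
  destruct (rot _ _ v6 v5) as (q1 & q2 & q3 & q4).
  split; [auto|split]; lra.
- unfold spread; rewrite sin_minus, cos_minus, sin_neg, cos_neg; fold c s.
  destruct (rot _ _ v7 v8) as (r1 & r2 & r3 & r4).
  destruct (rot _ _ v8 v7) as (q1 & q2 & q3 & q4).
  split; [auto|split]; lra.
- unfold spread; rewrite sin_minus, cos_minus, neg_sin, neg_cos; fold c s.
  destruct (rot _ _ v1 v2) as (r1 & r2 & r3 & r4).
  destruct (rot _ _ v2 v1) as (q1 & q2 & q3 & q4).
  split; [auto|split]; lra.
Qed.
End NearSquare.

(** * The finite list of words and the case distinction *)

(* The argument lists the sides [k0], [k2], [k3] of a [corner]. *)
Definition corner_words (k : nat * nat * nat) : list (list nat) :=
  let '(k0, k2, k3) := k in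
  [ [k0; k2];
    [k0; k2; k3; k0; k2; k3];
    [k0; k2; k3; k0; k3; k2];
    [k2; k0; k2; k3; k0; k3; k2; k0];
    [k0; k2; k0; k2; k3; k0; k3; k2; k0; k2];
    [k0; k2; k0; k2; k3; k0; k2; k0; k2; k3] ++ [k0; k3; k2; k0; k2; k0; k3; k2; k0; k2];
    [k0; k2; k0; k2; k0; k2; k3; k0; k2; k0; k2; k0; k2; k3] ++
      [k0; k3; k2; k0; k2; k0; k2; k0; k3; k2; k0; k2; k0; k2] ].

Definition near_square_words : list (list nat) :=
  [ [0; 1; 2; 0; 3; 2; 1; 3]; [1; 2; 3; 1; 0; 3; 2; 0] ]%nat ++
  flat_map corner_words
    [ (0, 2, 3); (1, 3, 0); (2, 0, 1); (3, 1, 2);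
      (3, 1, 0); (0, 2, 1); (1, 3, 2); (2, 0, 3) ]%nat.

Lemma near_square_words_even (W : list nat) : In W near_square_words -> Nat.Even (length W).
Proof.
intro h; apply Nat.even_spec.
assert (hall : forallb (fun W => Nat.even (length W)) near_square_words = true) by reflexivity.
rewrite forallb_forall in hall; auto.
Qed.

Lemma corner_path (a : qparams) (sg om : R) (k0 k2 k3 : nat) (A : pt) (e d l p q : R) :
  corner a sg om k0 k2 k3 A e d l p q -> 0 < e < 1 / 16 -> - (1 / 16) < d -> 2 * d <= e ->
  exists W, In W (corner_words (k0, k2, k3)) /\ has_periodic_path a W.
Proof.
intros c he hd hde.
destruct (Rtotal_order d 0) as [h | [h | h]];
  [ | | destruct (Rtotal_order e (3 * d)) as [h' | [h' | h']];
      [destruct (Req_dec e (2 * d)) as [h'' | h''] | |] ];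
  eexists; (split; [|
    first [ apply (path_fagnano a sg om k0 k2 k3 A e d l p q c he); lra
          | apply (path_right a sg om k0 k2 k3 A e d l p q c he h)
          | apply (path_half a sg om k0 k2 k3 A e d l p q c he h'')
          | apply (path_above_third a sg om k0 k2 k3 A e d l p q c he); lra
          | apply (path_third a sg om k0 k2 k3 A e d l p q c he h')
          | apply (path_below_third a sg om k0 k2 k3 A e d l p q c he); lra ] ]);
  simpl; auto 10.
Qed.

Theorem theorem2p2p4 :
  exists Ws : list (list nat),
    (forall W, In W Ws -> Nat.Even (length W)) /\
    forall a : qparams, in_Q a -> near_square (PI / 107) a ->
      exists W, In W Ws /\ orbit_tile W a.
Proof.
exists near_square_words; split; [exact near_square_words_even|].
intros a hQ (n1 & n2 & n3 & n4); unfold orbit_tile.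
pose proof eps_lt as he.
apply Rabs_def2 in n1, n2, n3, n4.
assert (h1 : near_quarter (a1 a)) by (unfold near_quarter; lra).
assert (h2 : near_quarter (a2 a)) by (unfold near_quarter; lra).
assert (h3 : near_quarter (a3 a)) by (unfold near_quarter; lra).
assert (h4 : near_quarter (a4 a)) by (unfold near_quarter; lra).
pose proof (near_balanced a h1 h2 h3 h4) as hb.
pose proof (path_AC a h1 h2 h3 h4) as hAC; pose proof (path_BD a h1 h2 h3 h4) as hBD.
(* Each acuteness is, up to sign, the sum of two deviations from [PI / 4], both below 1/32. *)
assert (sA : - (1 / 16) < acuteA a < 1 / 16) by (unfold acuteA; lra).
assert (sB : - (1 / 16) < acuteB a < 1 / 16) by (unfold acuteB; lra).
assert (sC : - (1 / 16) < acuteC a < 1 / 16) by (unfold acuteC; lra).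
assert (sD : - (1 / 16) < acuteD a < 1 / 16) by (unfold acuteD; lra).
assert (sum : acuteA a + acuteB a + acuteC a + acuteD a = 0) by (unfold acuteA, acuteB, acuteC, acuteD; lra).
assert (at_corner : forall k sg om A e d l p q k0 k2 k3, k = (k0, k2, k3) ->
  In k [ (0, 2, 3); (1, 3, 0); (2, 0, 1); (3, 1, 2);
         (3, 1, 0); (0, 2, 1); (1, 3, 2); (2, 0, 3) ]%nat ->
  corner a sg om k0 k2 k3 A e d l p q -> 0 < e < 1 / 16 -> - (1 / 16) < d -> 2 * d <= e ->
  exists W, In W near_square_words /\ in_Q a /\ has_periodic_path a W).
{ intros k sg om A e d l p q k0 k2 k3 -> hk c c1 c2 c3.
  destruct (corner_path a sg om k0 k2 k3 A e d l p q c c1 c2 c3) as (W & hW & hp).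
  exists W; split; auto; apply in_or_app; right; apply in_flat_map; eauto. }
(* As the sum is 0 and [acuteC a <= 0], [- acuteB a - acuteD a <= acuteA a], so one of the two
   neighbours satisfies [2 * d <= e]. The other three vertices are treated alike. *)
assert (atA : 0 < acuteA a -> acuteC a <= 0 -> exists W, In W near_square_words /\ in_Q a /\ has_periodic_path a W).
{ intros; destruct (Rle_or_lt (2 * - acuteD a) (acuteA a)).
  - eapply (at_corner (0, 2, 3)%nat); [reflexivity | simpl; auto 10 | apply corner_AD; auto | lra ..].
  - eapply (at_corner (3, 1, 0)%nat); [reflexivity | simpl; auto 10 | apply corner_AB; auto | lra ..]. }
assert (atB : 0 < acuteB a -> acuteD a <= 0 -> exists W, In W near_square_words /\ in_Q a /\ has_periodic_path a W).
{ intros; destruct (Rle_or_lt (2 * - acuteA a) (acuteB a)).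
  - eapply (at_corner (1, 3, 0)%nat); [reflexivity | simpl; auto 10 | apply corner_BA; auto | lra ..].
  - eapply (at_corner (0, 2, 1)%nat); [reflexivity | simpl; auto 10 | apply corner_BC; auto | lra ..]. }
assert (atC : 0 < acuteC a -> acuteA a <= 0 -> exists W, In W near_square_words /\ in_Q a /\ has_periodic_path a W).
{ intros; destruct (Rle_or_lt (2 * - acuteB a) (acuteC a)).
  - eapply (at_corner (2, 0, 1)%nat); [reflexivity | simpl; auto 10 | apply corner_CB; auto | lra ..].
  - eapply (at_corner (1, 3, 2)%nat); [reflexivity | simpl; auto 10 | apply corner_CD; auto | lra ..]. }
assert (atD : 0 < acuteD a -> acuteB a <= 0 -> exists W, In W near_square_words /\ in_Q a /\ has_periodic_path a W).
{ intros; destruct (Rle_or_lt (2 * - acuteC a) (acuteD a)).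
  - eapply (at_corner (3, 1, 2)%nat); [reflexivity | simpl; auto 10 | apply corner_DC; auto | lra ..].
  - eapply (at_corner (2, 0, 3)%nat); [reflexivity | simpl; auto 10 | apply corner_DA; auto | lra ..]. }
destruct (Rlt_or_le 0 (acuteA a)) as [pA | pA]; destruct (Rlt_or_le 0 (acuteC a)) as [pC | pC]; auto.
{ exists [0; 1; 2; 0; 3; 2; 1; 3]%nat; split; [simpl; auto | split; auto; apply hAC; lra]. }
destruct (Rlt_or_le 0 (acuteB a)) as [pB | pB]; destruct (Rlt_or_le 0 (acuteD a)) as [pD | pD]; auto.
{ exists [1; 2; 3; 1; 0; 3; 2; 0]%nat; split; [simpl; auto | split; auto; apply hBD; lra]. }
(* No acuteness is positive and they add up to 0, so all vanish. *)
exists [0; 2]%nat; split; [simpl; auto | split; auto].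
eapply path_rectangle; [apply corner_AD; auto | lra ..].
Qed.
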